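(* Let $\ell\ge1$ be an integer (with $C_1^{(1)}=A_1^{(1)}$). With the level $-1$ affine vertex operator algebra $\widetilde L_{C_\ell^{(1)}}(-\Lambda_0)\subset L_{C_\ell^{(1)}}(-\tfrac12\Lambda_0)\otimes L_{C_\ell^{(1)}}(-\tfrac12\Lambda_0)$ and the one-dimensional space $\mathfrak h_1=\mathbb C H$ described in the context, there is an isomorphism of vertex algebras $$\mathrm{Com}\big(\widetilde L_{C_\ell^{(1)}}(-\Lambda_0),\ L_{C_\ell^{(1)}}(-\tfrac12\Lambda_0)\otimes L_{C_\ell^{(1)}}(-\tfrac12\Lambda_0)\big)\ \cong\ M_{\mathfrak h_1}(1)^+ .$$
   Context: All vertex algebras are over $\mathbb C$. For a vertex subalgebra $U\subset V$, $\mathrm{Com}(U,V)=\{v\in V \mid u_n v=0 \text{ for all } u\in U,\ n\ge 0\}$. $L_{X_n^{(1)}}(k\Lambda_0)$, $k\neq -h^\vee$, is the simple affine vertex operator algebra of level $k$ of type $X_n^{(1)}$. Heisenberg algebra: for a finite-dimensional space $\mathfrak h$ with nondegenerate symmetric bilinear form, $M_{\mathfrak h}(1)=S(\mathfrak h\otimes t^{-1}\mathbb C[t^{-1}])$ is the associated Heisenberg (free boson) vertex operator algebra of level 1, and $M_{\mathfrak h}(1)^+$ is the subalgebra of fixed points of the order-two automorphism lifted from $h\mapsto -h$, $h\in\mathfrak h$. Weyl vertex algebra $M_m$: the algebra with generators $a_i^\pm(r)$, $r\in\tfrac12+\mathbb Z$, $1\le i\le m$, and only non-trivial relations $[a_i^+(r),a_j^-(s)]=\delta_{r+s,0}\delta_{i,j}$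 has an irreducible module $M_m$ generated by $\mathbf 1$ with $a_i^\pm(r)\mathbf 1=0$ for $r>0$; the fields $a_i^\pm(z)=\sum_{n\in\mathbb Z}a_i^\pm(n+\tfrac12)z^{-n-1}$ generate on $M_m$ a unique simple vertex algebra structure. Let $M_m^0$ be the fixed points of the automorphism $a_i^\pm(r)\mapsto -a_i^\pm(r)$. It is known that $M_\ell^0\cong L_{C_\ell^{(1)}}(-\tfrac12\Lambda_0)$. In $M_{2\ell}$ put, for $i=1,\dots,\ell$, $b_i^+=\tfrac1{\sqrt2}(a_i^+(-\tfrac12)+a_{2\ell+1-i}^-(-\tfrac12))\mathbf 1$, $b_{2\ell+1-i}^+=\tfrac{\sqrt{-1}}{\sqrt2}(a_i^+(-\tfrac12)-a_{2\ell+1-i}^-(-\tfrac12))\mathbf 1$, $b_i^-=\tfrac1{\sqrt2}(a_i^-(-\tfrac12)-a_{2\ell+1-i}^+(-\tfrac12))\mathbf 1$, $b_{2\ell+1-i}^-=\tfrac{-\sqrt{-1}}{\sqrt2}(a_i^-(-\tfrac12)+a_{2\ell+1-i}^+(-\tfrac12))\mathbf 1$. The subalgebra generated by the $b_i^\pm$ ($1\le i\le\ell$) and the one generated by the $b_{2\ell+1-i}^\pm$ ($1\le i\le \ell$) are each isomorphic to $M_\ell$, and $M_{2\ell}$ is their tensor product. Then $L_{C_\ell^{(1)}}(-\tfrac12\Lambda_0)\otimes L_{C_\ell^{(1)}}(-\tfrac12\Lambda_0)$ is identified with $M_\ell^0\otimes M_\ell^0\subset M_\ell\otimes M_\ell=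 M_{2\ell}$ for this decomposition. $\widetilde L_{C_\ell^{(1)}}(-\Lambda_0)$ is the vertex subalgebra of $M_\ell^0\otimes M_\ell^0$ generated by the following vectors, where $1\le i\le\ell$ in the first line and $1\le i<j\le\ell$ in the others: $e_{2\epsilon_i}=a_i^+(-\tfrac12)a_{2\ell+1-i}^-(-\tfrac12)\mathbf 1$, $f_{2\epsilon_i}=a_i^-(-\tfrac12)a_{2\ell+1-i}^+(-\tfrac12)\mathbf 1$; $e_{\epsilon_i+\epsilon_j}=\tfrac12(a_i^+(-\tfrac12)a_{2\ell+1-j}^-(-\tfrac12)+a_j^+(-\tfrac12)a_{2\ell+1-i}^-(-\tfrac12))\mathbf 1$; $f_{\epsilon_i+\epsilon_j}=\tfrac12(a_i^-(-\tfrac12)a_{2\ell+1-j}^+(-\tfrac12)+a_j^-(-\tfrac12)a_{2\ell+1-i}^+(-\tfrac12))\mathbf 1$; $e_{\epsilon_i-\epsilon_j}=\tfrac12(a_i^+(-\tfrac12)a_j^-(-\tfrac12)-a_{2\ell+1-j}^+(-\tfrac12)a_{2\ell+1-i}^-(-\tfrac12))\mathbf 1$; $f_{\epsilon_i-\epsilon_j}=\tfrac12(a_j^+(-\tfrac12)a_i^-(-\tfrac12)-a_{2\ell+1-i}^+(-\tfrac12)a_{2\ell+1-j}^-(-\tfrac12))\mathbf 1$. It is a (not a priori simple) affine vertex operator algebra of level $-1$ associated to $C_\ell^{(1)}$. $\mathfrak h_1=\mathbb C H$ with $H=\sum_{i=1}^{2\ell}a_i^+(-\tfrac12)a_i^-(-\tfrac12)\mathbf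 1\in M_{2\ell}$ and $\langle H,H\rangle=-2\ell$. *)

(* Defs.v *)
From HB Require Import structures.
From mathcomp Require Import all_boot all_order all_algebra.
From mathcomp Require Import complex.
From mathcomp Require Import classical_sets functions reals.
From mathcomp.multinomials Require Import monalg.

Set Implicit Arguments.
Unset Strict Implicit.
Unset Printing Implicit Defensive.

Import Order.TTheory GRing.Theory Num.Theory.
Local Open Scope classical_set_scope.
Local Open Scope ring_scope.

(* Binomial coefficient p (p - 1) ... (p - i + 1) / i! with integral, possibly
   negative, upper index. *)
Definition zbin (C : numFieldType) (p : int) (i : nat) : C :=
  (\prod_(j < i) (p%:~R - j%:R)) / i`!%:R.

(* [Y u n v] is the n-th product u_n v, with Y(u,z) = \sum_n u_n z^(-n-1).
   In the Borcherds identity both sums over i : nat have finitely many nonzero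
   terms by [Y_trunc]; they are compared through their partial sums of large
   length. *)
HB.mixin Record isVertexAlgebra (C : numFieldType) V of GRing.Lmodule C V := {
  vac : V;
  Y : V -> int -> V -> V;
  Y_linearl : forall (n : int) (v : V), linear (fun u => Y u n v);
  Y_linearr : forall (u : V) (n : int), linear (Y u n);
  Y_trunc : forall u v : V, exists N : int,
    forall n : int, N <= n -> Y u n v = 0;
  Y_vacl : forall (n : int) (v : V), Y vac n v = if n == -1 then v else 0;
  Y_vacr_ge0 : forall (v : V) (n : nat), Y v n vac = 0;
  Y_vacrN1 : forall v : V, Y v (-1) vac = v;
  Y_borcherds : forall (u v w : V) (p q r : int),
    exists N : nat, forall n : nat, (N <= n)%N ->
      \sum_(i < n) zbin C p i *: Y (Y u (r + i%:Z) v) (p + q - i%:Z) w =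
      \sum_(i < n) ((-1) ^+ i * zbin C r i) *:
         (Y u (p + r - i%:Z) (Y v (q + i%:Z) w)
          - ((-1 : C) ^ r) *: Y v (q + r - i%:Z) (Y u (p + i%:Z) w))
}.

#[short(type="vertexAlgType")]
HB.structure Definition VertexAlgebra (C : numFieldType) :=
  {V of GRing.Lmodule C V & isVertexAlgebra C V}.

Arguments vac {C} V : rename.

Section VertexAlgebraTheory.
Variable C : numFieldType.

Definition is_subspace (V : lmodType C) (A : set V) : Prop :=
  A 0 /\ forall (c : C) (u v : V), A u -> A v -> A (c *: u + v).

Definition lin_span (V : lmodType C) (G : set V) : set V :=
  smallest (@is_subspace V) G.

Definition is_subva (V : vertexAlgType C) (A : set V) : Prop :=
  [/\ is_subspace A, A (vac V) &
      forall (u v : V) (n : int), A u -> A v -> A (Y u n v)].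

Definition va_gen (V : vertexAlgType C) (G : set V) : set V :=
  smallest (@is_subva V) G.

(* Com(U, A), for subalgebras U and A of V. *)
Definition com (V : vertexAlgType C) (U A : set V) : set V :=
  [set v | A v /\ forall u, U u -> forall n : nat, Y u n v = 0].

(* Internal tensor product of two commuting subalgebras A and B: the image of
   u \otimes v |-> u_{-1} v. *)
Definition va_tensor (V : vertexAlgType C) (A B : set V) : set V :=
  lin_span [set Y u (-1) v | u in A & v in B].

(* f restricts to an isomorphism of vertex algebras from the subalgebra A of V
   onto the subalgebra B of W; the values of f outside A are irrelevant. *)
Definition va_iso (V W : vertexAlgType C) (A : set V) (B : set W)
    (f : V -> W) : Prop :=
  [/\ set_bij A B f,
      forall (c : C) (u v : V), A u -> A v -> f (c *: u + v) = c *: f u + f v,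
      f (vac V) = vac W &
      forall (u v : V) (n : int), A u -> A v -> f (Y u n v) = Y (f u) n (f v)].

Definition fixed_in (V : Type) (A : set V) (s : V -> V) : set V :=
  [set v | A v /\ s v = v].

(* V is the Weyl vertex algebra M_m, with ap i = a_i^+(-1/2) 1 and
   am i = a_i^-(-1/2) 1.  The operator a_i^\pm(p + 1/2) is the p-th mode of
   ap i, resp. am i, so r + s = 0 reads p + q = -1.  That a_i^\pm(r) 1 = 0 for
   r > 0 is [Y_vacr_ge0]; that 1 generates the module is irreducibility. *)
Record is_weyl (m : nat) (V : vertexAlgType C) (ap am : 'I_m -> V) : Prop := {
  weyl_pm : forall (i j : 'I_m) (p q : int) (v : V),
    Y (ap i) p (Y (am j) q v) - Y (am j) q (Y (ap i) p v) =
    if (p + q == -1) && (i == j) then v else 0;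
  weyl_pp : forall (i j : 'I_m) (p q : int) (v : V),
    Y (ap i) p (Y (ap j) q v) = Y (ap j) q (Y (ap i) p v);
  weyl_mm : forall (i j : 'I_m) (p q : int) (v : V),
    Y (am i) p (Y (am j) q v) = Y (am j) q (Y (am i) p v);
  weyl_neq0 : vac V <> 0;
  weyl_irr : forall A : set V, is_subspace A ->
    (forall (i : 'I_m) (p : int) (v : V),
       A v -> A (Y (ap i) p v) /\ A (Y (am i) p v)) ->
    A = [set 0] \/ A = setT
}.

(* S(h \otimes t^{-1} C[t^{-1}]): the polynomial algebra on the variables
   e_i \otimes t^{-n-1}, for n : nat and e the basis [vbasis {:h}] of h. *)
Notation fock h := {malg C[{cmonom ('I_(\dim (fullv : {vspace h})) * nat)%type}]}.

(* F is the Heisenberg vertex algebra M_h(1) of the quadratic space (h, form),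
   with iota x = x(-1) 1, so that the operator x(m) is the m-th mode of iota x.
   phi identifies F with the Fock space, each x(-n-1) acting there as the
   multiplication by x \otimes t^{-n-1}; x(m) 1 = 0 for m >= 0 is
   [Y_vacr_ge0]. *)
Record is_heisenberg (h : vectType C) (form : h -> h -> C)
    (F : vertexAlgType C) (iota : {linear h -> F}) : Prop := {
  heis_form_linear : forall (x : h) (c : C) (y z : h),
    form x (c *: y + z) = c * form x y + form x z;
  heis_form_sym : forall x y : h, form x y = form y x;
  heis_form_nondeg : forall x : h, (forall y : h, form x y = 0) -> x = 0;
  heis_comm : forall (x y : h) (m n : int) (v : F),
    Y (iota x) m (Y (iota y) n v) - Y (iota y) n (Y (iota x) m v) =
    if m + n == 0 then (m%:~R * form x y) *: v else 0;
  heis_fock : exists phi : {linear fock h -> F},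
    [/\ bijective phi, phi 1 = vac F &
        forall (i : 'I_(\dim (fullv : {vspace h}))) (n : nat) (p : fock h),
          phi (<< ucm (i, n) >> * p) =
          Y (iota (vbasis (fullv : {vspace h}))`_i) (- (n.+1)%:Z) (phi p)]
}.

End VertexAlgebraTheory.

(* Vectors of M_{2 l}.  The indices 1, ..., 2 l are shifted to 0, ..., 2 l - 1,
   so that 2 l + 1 - i becomes [rev_ord i] and 1 <= i <= l becomes i < l.  In
   both families b^+ and b^- below, the index l <= i stands for 2 l + 1 - j
   with j = rev_ord i. *)
Section LevelMinusOne.
Variables (C : numClosedFieldType) (l : nat) (V : vertexAlgType C).
Variables ap am : 'I_(2 * l) -> V.

Definition bp (i : 'I_(2 * l)) : V :=
  if (i < l)%N then (sqrtC 2)^-1 *: (ap i + am (rev_ord i))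
  else ('i / sqrtC 2) *: (ap (rev_ord i) - am i).

Definition bm (i : 'I_(2 * l)) : V :=
  if (i < l)%N then (sqrtC 2)^-1 *: (am i - ap (rev_ord i))
  else (- 'i / sqrtC 2) *: (am (rev_ord i) + ap i).

Definition bset1 : set V :=
  [set v | exists2 i : 'I_(2 * l), (i < l)%N & v = bp i \/ v = bm i].
Definition bset2 : set V :=
  [set v | exists2 i : 'I_(2 * l), (l <= i)%N & v = bp i \/ v = bm i].

Definition e_long (i : 'I_(2 * l)) : V := Y (ap i) (-1) (am (rev_ord i)).
Definition f_long (i : 'I_(2 * l)) : V := Y (am i) (-1) (ap (rev_ord i)).
Definition e_sum (i j : 'I_(2 * l)) : V :=
  2^-1 *: (Y (ap i) (-1) (am (rev_ord j)) + Y (ap j) (-1) (am (rev_ord i))).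
Definition f_sum (i j : 'I_(2 * l)) : V :=
  2^-1 *: (Y (am i) (-1) (ap (rev_ord j)) + Y (am j) (-1) (ap (rev_ord i))).
Definition e_diff (i j : 'I_(2 * l)) : V :=
  2^-1 *: (Y (ap i) (-1) (am j) - Y (ap (rev_ord j)) (-1) (am (rev_ord i))).
Definition f_diff (i j : 'I_(2 * l)) : V :=
  2^-1 *: (Y (ap j) (-1) (am i) - Y (ap (rev_ord i)) (-1) (am (rev_ord j))).

Definition LC_gens : set V :=
  [set v | exists2 i : 'I_(2 * l), (i < l)%N & v = e_long i \/ v = f_long i]
  `|` [set v | exists i j : 'I_(2 * l), (i < j < l)%N /\
         [\/ v = e_sum i j, v = f_sum i j, v = e_diff i j | v = f_diff i j]].

(* The level -1 affine vertex algebra of type C_l. *)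
Definition LC : set V := va_gen LC_gens.

Definition weyl_H : V := \sum_(i < 2 * l) Y (ap i) (-1) (am i).

End LevelMinusOne.

(* Main.v *)
Require Import Defs.
From HB Require Import structures.
From mathcomp Require Import all_boot all_order all_algebra.
From mathcomp Require Import complex.
From mathcomp Require Import classical_sets functions reals.
From mathcomp Require Import boolp ring zify.
From mathcomp.finmap Require Import finmap.
From mathcomp.multinomials Require Import monalg.
Import Order.TTheory GRing.Theory Num.Theory.

Set Implicit Arguments.
Unset Strict Implicit.
Unset Printing Implicit Defensive.
Local Open Scope classical_set_scope.
Local Open Scope ring_scope.

(** Write M for the Weyl vertex algebra of rank 2l, H for the weight one vector
    sum_i a_i^+ a_i^-, and k = -2l, so that H_m H_n - H_n H_m = m k
    delta_{m+n,0}.  The affine subalgebra of type C_l and the Heisenberg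
    subalgebra S generated by H are a commuting pair inside M, of Sp(2l) x O(2)
    type.

    The commutant in all of M is computed first.  It contains H, since H_n
    kills every generator of the affine algebra for n >= 0.  Conversely, a
    Casimir sum of the 4 l^2 symplectic currents equals
      2 (H_{-1} H) - 4 l P,
    where -P/2 is the conformal vector of M ([casimir]): the two subalgebras are
    conformally embedded, in accordance with the central charges -(2l+1), 1 and
    -2l.  Hence on a vector v of the commutant the mode (H_{-1} H)_1 acts as
    2 l P_1 ([sugawara]).  Now P_1 is diagonalizable on M with eigenvalues among
    0, -1, -2, ..., and its kernel is spanned by the vacuum.  If P_1 v = - n v, the vectors H_i v with
    i > 0 are in the commutant with larger eigenvalue, hence in S by
    induction on n, and expanding (H_{-1} H)_1 v gives
      - 2 l n v - H_0 H_0 v in S.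
    Splitting v into H_0-eigenvectors, with integral eigenvalues c, the scalar
    - (2 l n + c^2) is nonzero for n > 0, so v is in S ([com_eigen_heis],
    [com_LC_heis]).  The argument is uniform in l >= 1.

    Next comes parity.  In terms of the rotated generators b^+ and b^-, H is a
    combination of products of one generator of the first factor by one of the
    second ([weyl_H_rotated]).  So every mode of H exchanges the even-even part
    T_0 of the tensor product, which is the tensor product of the fixed point
    algebras, and the odd-odd part T_1 ([tensor_part_H]).  These two parts meet
    only in 0, because the zero mode of the number current of the second factor
    has even eigenvalues on T_0 and odd ones on T_1
    ([tensor_part_disjoint]).

    Finally, S is compared with the given Heisenberg vertex algebra F, generated
    by h, with the lift of h |-> - h.  In the product vertex algebra M x F, the
    subalgebra generated by (H, h) is the graph of a bijection from S to F, because a Heisenberg vertex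
    algebra with nonzero level is simple ([heis_simple], [heis_graph_inj],
    [heis_graph_fun]).  Being a subalgebra, the graph respects all products; as
    both gradings by parity are flipped by the modes of (H, h), the bijection
    matches the part of S in T_0 with the fixed points of the lift. *)

(** * Binomial coefficients *)

Section Zbin.
Variable C : numFieldType.

Lemma zbin0 (p : int) : zbin C p 0 = 1.
Proof. by rewrite /zbin big_ord0 fact0 divr1. Qed.

Lemma zbinS (p : int) (i : nat) :
  zbin C p i.+1 = zbin C p i * (p%:~R - i%:R) / i.+1%:R.
Proof.
rewrite /zbin big_ord_recr /= factS natrM.
by rewrite [_.+1%:R * _]mulrC invfM mulrA; congr (_ * _); rewrite mulrAC.
Qed.

Lemma zbin1 (p : int) : zbin C p 1 = p%:~R.
Proof. by rewrite zbinS zbin0 mul1r subr0 divr1. Qed.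

Lemma zbin0l (i : nat) : zbin C 0 i = (i == 0)%:R.
Proof.
case: i => [|i]; first by rewrite zbin0.
elim: i => [|i IH]; first by rewrite zbin1.
by rewrite zbinS IH mul0r mul0r.
Qed.

Lemma zbinN1 (i : nat) : zbin C (-1) i = (-1) ^+ i.
Proof.
elim: i => [|i IH]; first by rewrite zbin0.
rewrite zbinS IH exprS.
have h2 : i%:R + 1 != 0 :> C by rewrite natr1 pnatr_eq0.
by rewrite -natr1; field.
Qed.

End Zbin.

(** * Subspaces *)

Section Subspaces.
Variable C : numFieldType.

Section Closure.
Variables (V : lmodType C) (A : set V).
Hypothesis sA : is_subspace A.

Lemma subspace0 : A 0. Proof. by case: sA. Qed.
Lemma subspaceD u v : A u -> A v -> A (u + v).
Proof. by move=> Au Av; rewrite -[u]scale1r; case: sA => _; apply. Qed.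
Lemma subspaceZ c u : A u -> A (c *: u).
Proof. by move=> Au; rewrite -[_ *: _]addr0; case: sA => A0; apply. Qed.
Lemma subspaceN u : A u -> A (- u).
Proof. by move=> Au; rewrite -scaleN1r; apply: subspaceZ. Qed.
Lemma subspaceB u v : A u -> A v -> A (u - v).
Proof. by move=> Au Av; apply: subspaceD => //; apply: subspaceN. Qed.
Lemma subspace_sum I (r : seq I) (P : pred I) (F : I -> V) :
  (forall i, P i -> A (F i)) -> A (\sum_(i <- r | P i) F i).
Proof. by move=> h; elim/big_ind: _ => //; [apply: subspace0 | apply: subspaceD]. Qed.
End Closure.

Lemma lin_span_subspace (V : lmodType C) (G : set V) : is_subspace (lin_span G).
Proof.
split=> [A [[]] //|c u v hu hv A hA].
by case: (hA) => [[_ h] _]; apply: h; [apply: hu|apply: hv].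
Qed.

Lemma sub_lin_span (V : lmodType C) (G : set V) : G `<=` lin_span G.
Proof. by move=> v Gv A [_]; apply. Qed.

Lemma lin_span_min (V : lmodType C) (G A : set V) :
  is_subspace A -> G `<=` A -> lin_span G `<=` A.
Proof. by move=> sA GA; apply: smallest_sub. Qed.

Lemma subspace_preim (V W : lmodType C) (A : set W) (f : {linear V -> W}) :
  is_subspace A -> is_subspace (f @^-1` A).
Proof.
move=> sA; split=> [|c u v] /=; first by rewrite linear0; apply: subspace0.
by move=> hu hv; rewrite linearP; apply: subspaceD => //; apply: subspaceZ.
Qed.

Lemma subspace_set0 (V : lmodType C) : is_subspace [set 0 : V].
Proof. by split=> // c u v /= -> ->; rewrite scaler0 addr0. Qed.

Lemma subspace_ker (V : lmodType C) (f : {linear V -> V}) (c : C) :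
  is_subspace [set v | f v = c *: v].
Proof.
split=> /= [|a u v hu hv]; first by rewrite linear0 scaler0.
by rewrite linearP hu hv scalerDr !scalerA mulrC.
Qed.
End Subspaces.
#[global] Hint Resolve lin_span_subspace : core.

(** * Modes, commuting vectors and generated subalgebras *)

Section VA.
Variables (C : numFieldType) (V : vertexAlgType C).
Implicit Types (u v w : V) (A B X : set V).

HB.instance Definition _ u n := GRing.isLinear.Build C V V *:%R (Y u n) (Y_linearr u n).

Definition Yl (n : int) v := fun u => Y u n v.
HB.instance Definition _ n v := GRing.isLinear.Build C V V *:%R (Yl n v) (Y_linearl n v).

Lemma YDl u u' n v : Y (u + u') n v = Y u n v + Y u' n v.
Proof. exact: (linearD (Yl n v)). Qed.
Lemma YBl u u' n v : Y (u - u') n v = Y u n v - Y u' n v.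
Proof. exact: (linearB (Yl n v)). Qed.
Lemma YZl c u n v : Y (c *: u) n v = c *: Y u n v.
Proof. exact: (linearZ_LR (Yl n v)). Qed.
Lemma Y0l n v : Y 0 n v = 0.
Proof. exact: (linear0 (Yl n v)). Qed.
Lemma YNl u n v : Y (- u) n v = - Y u n v.
Proof. exact: (linearN (Yl n v)). Qed.
Lemma Y_suml I (r : seq I) (P : pred I) (F : I -> V) n v :
  Y (\sum_(i <- r | P i) F i) n v = \sum_(i <- r | P i) Y (F i) n v.
Proof. exact: (linear_sum (Yl n v)). Qed.
Definition YDr u n v w : Y u n (v + w) = Y u n v + Y u n w := linearD (Y u n) v w.
Definition YZr u n c v : Y u n (c *: v) = c *: Y u n v := linearZ_LR (Y u n) c v.
Definition Y0r u n : Y u n 0 = 0 := linear0 (Y u n).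
Definition YNr u n v : Y u n (- v) = - Y u n v := linearN (Y u n) v.
Definition YBr u n v w : Y u n (v - w) = Y u n v - Y u n w := linearB (Y u n) v w.

(** The axioms [Y_vacr_ge0] and [Y_vacl] state vanishing with the zero of the raw
    structure; this lemma and the next one use the canonical zero. *)
Lemma Y_vac_ge0 v (n : nat) : Y v n (vac V) = 0.
Proof. exact: Y_vacr_ge0. Qed.

Lemma Y_vac (n : int) v : Y (vac V) n v = if n == -1 then v else 0.
Proof. exact: Y_vacl. Qed.

Lemma sum_ord_trunc (N n : nat) (F : nat -> V) : (N <= n)%N ->
  (forall i, (N <= i)%N -> F i = 0) -> \sum_(i < n) F i = \sum_(i < N) F i.
Proof.
move=> Nn h; rewrite -(subnKC Nn) big_split_ord /= [X in _ + X]big1 ?addr0 //.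
by move=> i _; apply: h; rewrite leq_addr.
Qed.

(** The case r = 0 of the Borcherds identity, where only the term i = 0 survives
    on the right; the vanishing assumption makes the length of the left sum
    explicit. *)
Lemma Y_commutator u v w (p q : int) (N : nat) :
  (forall i, (N <= i)%N -> Y u i%:Z v = 0) ->
  Y u p (Y v q w) - Y v q (Y u p w) =
  \sum_(i < N) zbin C p i *: Y (Y u i%:Z v) (p + q - i%:Z) w.
Proof.
move=> h; have [M hM] := Y_borcherds u v w p q 0.
have := hM (maxn N M.+1) _; rewrite (leq_trans (leqnSn _) (leq_maxr _ _)).
move=> /(_ isT); have -> : (maxn N M.+1 = (maxn N M.+1).-1.+1)%N by lia.
rewrite [RHS]big_ord_recl [X in _ = _ + X]big1 => [|i _]; last first.
  by rewrite zbin0l /= mulr0 scale0r.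
rewrite addr0 zbin0l mulr1 scale1r !(addr0, subr0) expr0z scale1r => <-.
rewrite (@sum_ord_trunc N _ (fun i => zbin C p i *: Y (Y u (0 + i%:Z) v) (p + q - i%:Z) w)); last 2 first.
- lia.
- by move=> i Ni; rewrite add0r h // Y0l scaler0.
by apply: eq_bigr => i _; rewrite add0r.
Qed.

(** The case p = 0 of the Borcherds identity: it expresses the modes of a product
    through the modes of its factors. *)
Lemma Y_assoc u v w (r q : int) : exists N : nat, forall n, (N <= n)%N ->
  Y (Y u r v) q w = \sum_(i < n) ((-1) ^+ i * zbin C r i) *:
     (Y u (r - i%:Z) (Y v (q + i%:Z) w)
      - ((-1 : C) ^ r) *: Y v (q + r - i%:Z) (Y u i%:Z w)).
Proof.
have [M hM] := Y_borcherds u v w 0 q r; exists M.+1 => n Mn.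
have := hM n (ltnW Mn); case: n Mn => // n Mn.
rewrite big_ord_recl [X in _ + X = _]big1 => [|i _]; last by rewrite zbin0l /= scale0r.
rewrite zbin0l scale1r !(addr0, subr0, add0r) => ->.
by apply: eq_bigr => i _; rewrite !add0r.
Qed.

(** The modes of a normally ordered product.  An explicit bound on the length of
    the sum is kept so that the product can be expanded on concrete vectors. *)
Lemma Y_assocN1 u v w (q : int) (N : nat) :
  (forall i, (N <= i)%N -> Y u i%:Z w = 0) ->
  (forall i, (N <= i)%N -> Y v (q + i%:Z) w = 0) ->
  Y (Y u (-1) v) q w =
  \sum_(i < N) (Y u (-1 - i%:Z) (Y v (q + i%:Z) w) + Y v (q - 1 - i%:Z) (Y u i%:Z w)).
Proof.
move=> hu hv; have [M hM] := Y_assoc u v w (-1) q.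
rewrite (hM (maxn N M)) ?leq_maxr //.
pose F (i : nat) := Y u (-1 - i%:Z) (Y v (q + i%:Z) w) + Y v (q - 1 - i%:Z) (Y u i%:Z w).
rewrite -(@sum_ord_trunc N (maxn N M) F) ?leq_maxl //; last first.
  by move=> i Ni; rewrite /F hu // hv // !Y0r addr0.
apply: eq_bigr => i _; rewrite zbinN1 -exprD addnn -mul2n exprM sqrrN expr1n expr1n scale1r.
by rewrite exprN1 invrN invr1 scaleN1r opprK.
Qed.

Lemma trunc2 u v w w' (q : int) : exists N : nat,
  (forall i, (N <= i)%N -> Y u i%:Z w = 0) /\
  (forall i, (N <= i)%N -> Y v (q + i%:Z) w' = 0).
Proof.
have [N1 h1] := Y_trunc u w; have [N2 h2] := Y_trunc v w'.
exists (absz N1 + absz (N2 - q))%N; split=> i hi; [apply: h1|apply: h2]; lia.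
Qed.

Lemma Y_mode_closed A u v w (r q : int) : is_subspace A ->
  (forall m n, A (Y u m (Y v n w))) -> (forall m n, A (Y v m (Y u n w))) ->
  A (Y (Y u r v) q w).
Proof.
move=> sA h1 h2; have [N hN] := Y_assoc u v w r q; rewrite (hN N) //.
by apply: subspace_sum => // i _; apply: subspaceZ => //; apply: subspaceB => //; apply: subspaceZ.
Qed.

Lemma va_gen_subva X : is_subva (va_gen X).
Proof.
split.
- split=> [A [[[]]] //|c u v hu hv A hA].
  by case: (hA) => [[[_ h] _ _] _]; apply: h; [apply: hu|apply: hv].
- by move=> A [[]].
- by move=> u v n hu hv A hA; case: (hA) => [[_ _ h] _]; apply: h; [apply: hu|apply: hv].
Qed.

Lemma sub_va_gen X : X `<=` va_gen X.
Proof. by move=> v Xv A [_]; apply. Qed.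

Lemma va_gen_min X A : is_subva A -> X `<=` A -> va_gen X `<=` A.
Proof. by move=> sA XA; apply: smallest_sub. Qed.

(** A subalgebra is spanned by iterated modes of its generators applied to the
    vacuum: by associativity, the vectors all of whose modes preserve A form a
    subalgebra. *)
Lemma va_gen_ind X A : is_subspace A -> A (vac V) ->
  (forall u p v, X u -> A v -> A (Y u p v)) -> va_gen X `<=` A.
Proof.
move=> sA A1 hX.
pose B : set V := [set u | forall n w, A w -> A (Y u n w)].
suff h : va_gen X `<=` B.
  by move=> u /h /(_ (-1) _ A1); rewrite Y_vacrN1.
apply: va_gen_min => [|u Xu n w Aw]; last exact: hX.
split.
- split=> [n w _|c u v hu hv n w Aw]; first by rewrite Y0l; apply: subspace0.
  by rewrite Y_linearl; apply: subspaceD => //; [apply: subspaceZ => //; apply: hu|apply: hv].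
- by move=> n w Aw; rewrite Y_vac; case: ifP => // _; apply: subspace0.
- move=> u v r hu hv n w Aw; apply: Y_mode_closed => // a b.
  + by apply/hu/hv.
  + by apply/hv/hu.
Qed.

Lemma subva_closed A u n v : is_subva A -> A u -> A v -> A (Y u n v).
Proof. by case=> _ _; apply. Qed.

Definition commuting u v := forall n : nat, Y u n v = 0.

Lemma commuting_modes u v : commuting u v ->
  forall p q w, Y u p (Y v q w) = Y v q (Y u p w).
Proof.
move=> h p q w; apply/eqP; rewrite -subr_eq0.
by rewrite (@Y_commutator u v w p q 0) ?big_ord0.
Qed.

(** As the modes commute, v_n u = v_n u_{-1} 1 = u_{-1} v_n 1 = 0. *)
Lemma commuting_sym u v : commuting u v -> commuting v u.
Proof.
move=> h n; rewrite -[u]Y_vacrN1 -(commuting_modes h) Y_vac_ge0.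
exact: Y0r.
Qed.

Lemma commuting_subva u : is_subva [set v | commuting u v].
Proof.
split=> /=.
- split=> [n|c v w hv hw n] /=; first exact: Y0r.
  by rewrite Y_linearr hv hw scaler0 addr0.
- exact: Y_vac_ge0.
- by move=> v w m hv hw n; rewrite (commuting_modes hv) hw Y0r.
Qed.

Lemma com_setT_subva X : is_subva (com X setT).
Proof.
split.
- split=> [|c u v [_ hu] [_ hv]].
  + by split=> // u Xu n; apply: Y0r.
  + by split=> // w Xw n; rewrite Y_linearr hu // hv // scaler0 addr0.
- by split=> // u Xu n; apply: Y_vac_ge0.
- move=> u v n [_ hu] [_ hv]; split=> // w Xw.
  by have [_ _] := commuting_subva w; apply; [apply: hu|apply: hv].
Qed.

Lemma va_gen_commuting X X' : (forall u v, X u -> X' v -> commuting u v) ->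
  forall u v, va_gen X u -> va_gen X' v -> commuting u v.
Proof.
move=> h; have h1 u v : X u -> va_gen X' v -> commuting u v.
  by move=> Xu; apply: (va_gen_min (commuting_subva u)) => t; apply: h.
move=> u v hu hv; apply: commuting_sym; move: u hu.
apply: (va_gen_min (commuting_subva v)) => t Xt.
by apply: commuting_sym; apply: h1.
Qed.

(** The modes of a vector commuting with v act on the left factor of u_{-1} v, as
    in a tensor product. *)
Lemma Y_tensorl x u v (p : int) : commuting x v -> commuting u v ->
  Y x p (Y u (-1) v) = Y (Y x p u) (-1) v.
Proof.
move=> hx hu; have [N hN] := Y_assoc x u v p (-1); rewrite (hN N.+1) //.
rewrite big_ord_recl [X in _ + X]big1 => [|i _].
  by rewrite zbin0 expr0 mul1r scale1r !(addr0, subr0) (hx 0%N) Y0r scaler0 subr0.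
have -> : -1 + (lift ord0 i)%:Z = i by rewrite lift0 -natz; lia.
by rewrite hu hx !Y0r scaler0 subr0 scaler0.
Qed.

(** The vector u_{-2} 1 is the translate of u.  In the Borcherds identity with
    r = -2 and q = 0 the right side vanishes, because it only involves modes of
    the vacuum of index >= 0 or <= -2. *)
Lemma Y_deriv u (n : int) w : Y (Y u (-2) (vac V)) n w = - n%:~R *: Y u (n - 1) w.
Proof.
have [N /(_ N.+2)] := Y_borcherds u (vac V) w n 0 (-2).
rewrite (ltnW (ltnW (leqnn _))) => /(_ isT).
rewrite [RHS]big1 => [|i _]; last first.
  rewrite !Y_vac; have -> : (0 + i%:Z == -1) = false by lia.
  have -> : (0 - 2 - i%:Z == -1) = false by lia.
  by rewrite Y0r scaler0 subrr scaler0.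
rewrite 2!big_ord_recl [X in _ + (_ + X)]big1 => [|i _]; last first.
  have -> : -2 + (lift ord0 (lift ord0 i))%:Z = i%:Z by rewrite !lift0; lia.
  by rewrite Y_vac_ge0 Y0l scaler0.
rewrite zbin0 zbin1 scale1r !(addr0, subr0) /= Y_vacrN1 => /eqP.
by rewrite addr_eq0 scaleNr => /eqP.
Qed.
End VA.

(** * Sums of eigenvectors *)

Section Eigen.
Variables (C : numFieldType) (V : lmodType C) (D : {linear V -> V}).
Implicit Types (L : set C) (J A : set V).

Definition eigsum L : set V := lin_span [set v | exists2 a, L a & D v = a *: v].

Lemma eigsum_subspace L : is_subspace (eigsum L).
Proof. exact: lin_span_subspace. Qed.

Lemma eigsum_eigen L a v : L a -> D v = a *: v -> eigsum L v.
Proof. by move=> La Dv; apply: sub_lin_span; exists a. Qed.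

Lemma sum_support (s t : seq C) (w : C -> V) : uniq s -> uniq t ->
  {subset s <= t} -> (forall a, a \notin s -> w a = 0) ->
  \sum_(a <- t) w a = \sum_(a <- s) w a.
Proof.
move=> us ut st w0; rewrite (bigID (mem s)) /= [X in _ + X]big1 ?addr0 //.
rewrite -big_filter; apply: perm_big; apply: uniq_perm; rewrite ?filter_uniq //.
move=> a; rewrite mem_filter /=; case: (boolP (a \in s)) => //= /st.
by [].
Qed.

(** The components are indexed by their eigenvalues through a function that
    vanishes outside a finite list, so that two decompositions can be added by
    merging the lists. *)
Lemma eigsum_repr L v : eigsum L v -> exists (s : seq C) (w : C -> V),
  [/\ uniq s, forall a, D (w a) = a *: w a, forall a, a \in s -> L a,
      forall a, a \notin s -> w a = 0 & v = \sum_(a <- s) w a].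
Proof.
move: v; apply: lin_span_min; last first.
  move=> v /= [a La Dv]; exists [:: a], (fun b => if b == a then v else 0).
  split=> // [b|b|b|]; rewrite ?inE.
  - by case: eqP => [->|_] //; rewrite linear0 scaler0.
  - by move/eqP->.
  - by move/negPf->.
  - by rewrite big_seq1 eqxx.
split.
  exists [::], (fun=> 0); split=> // [a|]; first by rewrite linear0 scaler0.
  by rewrite big_nil.
move=> c u v [s [w [us Dw sL w0 ->]]] [s' [w' [us' Dw' sL' w0' ->]]].
exists (undup (s ++ s')), (fun a => c *: w a + w' a); split.
- exact: undup_uniq.
- by move=> a; rewrite linearP Dw Dw' scalerDr !scalerA mulrC.
- by move=> a; rewrite mem_undup mem_cat => /orP[/sL|/sL'].
- move=> a; rewrite mem_undup mem_cat negb_or => /andP[/w0 -> /w0' ->].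
  by rewrite scaler0 addr0.
- rewrite big_split /= -scaler_sumr.
  congr (_ *: _ + _); symmetry; apply: sum_support => //; try exact: undup_uniq.
    by move=> a sa; rewrite mem_undup mem_cat sa.
  by move=> a sa; rewrite mem_undup mem_cat sa orbT.
Qed.

(** The usual elimination: applying D - a removes the component of eigenvalue a
    and rescales the others by nonzero factors. *)
Lemma eigen_components J (s : seq C) (w : C -> V) : is_subspace J ->
  (forall u, J u -> J (D u)) -> uniq s -> (forall a, D (w a) = a *: w a) ->
  J (\sum_(a <- s) w a) -> forall a, a \in s -> J (w a).
Proof.
move=> sJ DJ; elim: s w => [//|a s IH] w /= /andP[ans us] Dw.
rewrite big_cons => Jv.
have Js b : b \in s -> J (w b).
  move=> bs; have ba : b - a != 0.
    by rewrite subr_eq0; apply: contraNneq ans => <-.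
  rewrite -[w b]scale1r -(mulVf ba) -scalerA; apply: subspaceZ => //.
  apply: (IH (fun b => (b - a) *: w b)) => // [c|].
    by rewrite linearZ /= Dw !scalerA mulrC.
  suff -> : \sum_(c <- s) (c - a) *: w c =
    D (w a + \sum_(c <- s) w c) - a *: (w a + \sum_(c <- s) w c).
    by apply: subspaceB; [|apply: DJ|apply: subspaceZ].
  rewrite linearD /= Dw scalerDr opprD addrACA subrr add0r linear_sum /=.
  rewrite scaler_sumr -sumrB; apply: eq_bigr => c _.
  by rewrite Dw scalerBl.
move=> b; rewrite inE => /orP[/eqP ->|/Js //].
rewrite -[w a](addrK (\sum_(c <- s) w c)); apply: subspaceB => //.
by rewrite big_seq; apply: subspace_sum.
Qed.

(** The form in which diagonalizability is used: to prove that a vector of a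
    D-stable subspace J lies in A, the eigenvectors in J suffice. *)
Lemma eigsum_ind L J A v : is_subspace J -> (forall u, J u -> J (D u)) ->
  is_subspace A -> (forall a u, L a -> J u -> D u = a *: u -> A u) ->
  J v -> eigsum L v -> A v.
Proof.
move=> sJ DJ sA h Jv /eigsum_repr [s [w [us Dw sL _ vE]]].
rewrite vE big_seq; apply: subspace_sum => // a sa.
apply: (h a) => //; first exact: sL.
by apply: (eigen_components sJ DJ us Dw) => //; rewrite -vE.
Qed.

Lemma eigsum_eq0 L a v : eigsum L v -> D v = a *: v -> ~ L a -> v = 0.
Proof.
move=> Lv Dv La; apply: (@eigsum_ind L [set t | D t = a *: t] [set 0]) => //.
- exact: subspace_ker.
- by move=> u /= Du; rewrite Du linearZ /= Du.
- exact: subspace_set0.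
- move=> b u Lb /= -> /eqP; rewrite -subr_eq0 -scalerBl scaler_eq0.
  by case/orP => /eqP // /eqP; rewrite subr_eq0 => /eqP ab; rewrite ab in La.
Qed.

Lemma eigsum_disjoint L L' v : (forall a, L a -> ~ L' a) ->
  eigsum L v -> eigsum L' v -> v = 0.
Proof.
move=> LL' Lv L'v; apply: (@eigsum_ind L' (eigsum L) [set 0]) => //.
- exact: eigsum_subspace.
- move=> u; apply: (lin_span_min (subspace_preim _ (eigsum_subspace L))).
  move=> w /= [a La Dw]; rewrite Dw; apply: (eigsum_eigen La).
  by rewrite linearZ /= Dw.
- exact: subspace_set0.
- by move=> a u L'a Lu Du; apply: (eigsum_eq0 Lu Du) => /LL'.
Qed.

Lemma eigsum_shift L L' (f : {linear V -> V}) b v :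
  (forall w, D (f w) = f (D w) + b *: f w) -> (forall a, L a -> L' (a + b)) ->
  eigsum L v -> eigsum L' (f v).
Proof.
move=> Df LL'; apply: (lin_span_min (subspace_preim _ (eigsum_subspace L'))).
move=> w /= [a La Dw]; apply: (eigsum_eigen (LL' a La)).
by rewrite Df Dw linearZ /= scalerDl.
Qed.

Lemma eigsum_sub L L' v : L `<=` L' -> eigsum L v -> eigsum L' v.
Proof.
move=> LL'; move: v; apply: lin_span_min => [|v /= [a La Dv]]; first exact: eigsum_subspace.
exact: (eigsum_eigen (LL' a La)).
Qed.
End Eigen.

(** * Gradings of vertex algebras generated by free fields *)

Section Creation.
Variables (C : numFieldType) (V : vertexAlgType C).
Implicit Types (X A : set V).

Definition scalar_commuting X := forall u v, X u -> X v -> forall p q : int,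
  exists c : C, forall w, Y u p (Y v q w) = Y v q (Y u p w) + c *: w.

(** Poincare-Birkhoff-Witt in its weakest form: annihilation modes can be moved
    to the right, where they kill the vacuum, at the cost of scalars.  So the
    creation modes alone generate. *)
Lemma va_gen_creation X A : scalar_commuting X -> is_subspace A -> A (vac V) ->
  (forall u (n : nat) w, X u -> A w -> A (Y u (- n.+1%:Z) w)) -> va_gen X `<=` A.
Proof.
move=> scX sA A1 cA.
pose K B := is_subspace B /\
  forall u (n : nat) w, X u -> B w -> B (Y u (- n.+1%:Z) w).
pose U := smallest K [set vac V].
have UA : U `<=` A by apply: smallest_sub => // v ->.
have U1 : U (vac V) by move=> B [_]; apply.
have sU : is_subspace U.
  split=> [B [[[]]] //|c u v hu hv B hB].
  by case: (hB) => [[[_ h] _] _]; apply: h; [apply: hu|apply: hv].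
have cU u (n : nat) w : X u -> U w -> U (Y u (- n.+1%:Z) w).
  by move=> Xu Uw B hB; case: (hB) => [[_ h] _]; apply: h => //; apply: Uw.
have aU w : U w -> U w /\ forall u (n : nat), X u -> U (Y u n w).
  move: w; apply: smallest_sub; last first.
    by move=> _ ->; split=> // u n _; rewrite Y_vac_ge0; exact: subspace0.
  split; first split.
  - by split=> [|u n _]; rewrite ?Y0r; exact: subspace0.
  - move=> c u v [Uu hu] [Uv hv]; split; first by case: sU => _; apply.
    move=> t n Xt; rewrite Y_linearr; case: sU => _; apply; first exact: hu.
    exact: hv.
  - move=> u n w Xu [Uw hw]; split; first exact: cU.
    move=> t m Xt; have [c ->] := scX _ _ Xt Xu m (- n.+1%:Z).
    apply: (subspaceD sU); last exact: (subspaceZ sU).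
    by apply: cU => //; apply: hw.
apply: subset_trans UA; apply: va_gen_ind => // u p v Xu Uv.
case: p => n; first by apply: (aU _ Uv).2.
by rewrite NegzE; apply: cU.
Qed.

(** Every product of at least one creation mode is an eigenvector with eigenvalue
    in L.  The multiple of the vacuum is split off so that L may avoid 0, in
    which case the kernel of D is spanned by the vacuum. *)
Lemma va_gen_grading X (D : {linear V -> V}) (L : set C) : scalar_commuting X ->
  D (vac V) = 0 -> (forall a b, L a -> L b -> L (a + b)) ->
  (forall u (n : nat), X u -> exists2 b, L b & forall w,
      D (Y u (- n.+1%:Z) w) = Y u (- n.+1%:Z) (D w) + b *: Y u (- n.+1%:Z) w) ->
  forall v, va_gen X v -> exists c, eigsum D L (v - c *: vac V).
Proof.
move=> scX D1 LD hX; apply: va_gen_creation => //.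
- split=> [|a u v [c hc] [d hd]].
    by exists 0; rewrite scale0r subrr; exact: (subspace0 (eigsum_subspace _ _)).
  exists (a * c + d); rewrite scalerDl opprD addrACA -scalerA -scalerBr.
  by have [_] := eigsum_subspace D L; apply.
- by exists 1; rewrite scale1r subrr; exact: (subspace0 (eigsum_subspace _ _)).
- move=> u n w Xu [c hc]; exists 0; rewrite scale0r subr0.
  have [b Lb hb] := hX u n Xu.
  rewrite -[w](subrK (c *: vac V)) YDr; apply: (subspaceD (eigsum_subspace _ _)).
    by apply: (eigsum_shift hb) hc => a La; apply: LD.
  apply: (eigsum_eigen Lb); rewrite hb.
  by rewrite linearZ /= D1 scaler0 Y0r add0r.
Qed.

Lemma va_gen_weight0 X (D : {linear V -> V}) (L : set C) : scalar_commuting X ->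
  D (vac V) = 0 -> (forall a b, L a -> L b -> L (a + b)) ->
  (forall u (n : nat), X u -> exists2 b, L b & forall w,
      D (Y u (- n.+1%:Z) w) = Y u (- n.+1%:Z) (D w) + b *: Y u (- n.+1%:Z) w) ->
  ~ L 0 -> forall v, va_gen X v -> D v = 0 -> exists c, v = c *: vac V.
Proof.
move=> scX D1 LD hX L0 v hv Dv; have [c hc] := va_gen_grading scX D1 LD hX hv.
exists c; apply/eqP; rewrite -subr_eq0; apply/eqP.
apply: (eigsum_eq0 hc (a := 0)) => //.
by rewrite linearB linearZ /= D1 Dv scaler0 subrr scale0r.
Qed.
End Creation.

(** * Simplicity of the Heisenberg vertex algebra *)

Section Heisenberg.
Variables (C : numFieldType) (V : vertexAlgType C) (x : V) (k : C).
Hypothesis heis : forall (m n : int) (w : V),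
  Y x m (Y x n w) - Y x n (Y x m w) = if m + n == 0 then (m%:~R * k) *: w else 0.

Let S := va_gen [set x].
(** This is 2 k times the Sugawara conformal vector when k is nonzero. *)
Definition square := Y x (-1) x.
Local Notation D := (Y square 1).

Lemma heis_ope (n : nat) : Y x n x = if n == 1%N then k *: vac V else 0.
Proof.
rewrite -{2}[x]Y_vacrN1; have := heis n (-1) (vac V).
rewrite Y_vac_ge0 Y0r subr0 => ->.
have -> : (n%:Z + -1 == 0) = (n == 1%N) by lia.
by case: eqP => [->|//]; rewrite mul1r.
Qed.

Lemma heis_square (n : nat) : Y x n square = if n == 1%N then (2 * k) *: x else 0.
Proof.
rewrite /square; have /eqP := heis n (-1) x; rewrite subr_eq => /eqP ->.
rewrite heis_ope; have -> : (n%:Z + -1 == 0) = (n == 1%N) by lia.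
case: eqP => [->|_]; last by rewrite Y0r addr0.
by rewrite YZr Y_vacrN1 mul1r -scalerDl; congr (_ *: _); ring.
Qed.

Lemma heis_weight (n : int) w : D (Y x n w) = Y x n (D w) - (2 * k * n%:~R) *: Y x n w.
Proof.
have := @Y_commutator _ _ x square w n 1 2; rewrite !big_ord_recl big_ord0.
rewrite !heis_square /= Y0l scaler0 add0r addr0 zbin1 YZl scalerA => h.
have -> : (2 * k * n%:~R) *: Y x n w = Y x n (Y square 1 w) - Y square 1 (Y x n w).
  rewrite h => [|i i2]; last by rewrite heis_square; case: eqP i2 => // ->.
  rewrite mulrC; congr (_ *: Y _ _ _); exact/esym/addrK.
by rewrite opprB addrC subrK.
Qed.

(** The expansion D v = x_0 x_0 v + 2 (x_{-1} x_1 v + x_{-2} x_2 v + ...), read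
    modulo a subspace containing the x_i v for i > 0. *)
Lemma heis_square_mod (A : set V) v : is_subspace A ->
  (forall n w, A w -> A (Y x n w)) -> (forall n : nat, A (Y x n.+1 v)) ->
  A (D v - Y x 0 (Y x 0 v)).
Proof.
move=> sA xA hv; have [N [h1 h2]] := trunc2 x x v v 1.
rewrite /square (@Y_assocN1 _ _ x x v 1 N.+1); last 2 first.
- by move=> i Ni; apply: h1; apply: ltnW.
- by move=> i Ni; apply: h2; apply: ltnW.
rewrite big_split /= [X in _ + X - _]big_ord_recl /= !subr0 subrr.
rewrite [Y x 0 _ + _]addrC addrA addrK.
by apply: (subspaceD sA); apply: (subspace_sum sA) => i _; apply: xA;
  have := hv i.
Qed.

Lemma heis_scalar : scalar_commuting [set x].
Proof.
move=> _ _ -> -> p q; exists (if p + q == 0 then p%:~R * k else 0) => w.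
have /eqP := heis p q w; rewrite subr_eq addrC => /eqP ->.
by congr (_ + _); case: ifP; rewrite ?scale0r.
Qed.

Lemma heis_charge0 v : S v -> Y x 0 v = 0.
Proof.
apply: (va_gen_ind (A := [set v | Y x 0 v = 0])) => /=.
- split=> [|c u w] /=; first exact: Y0r.
  by move=> hu hw; rewrite Y_linearr hu hw scaler0 addr0.
- exact: (Y_vac_ge0 x 0).
- move=> _ p w -> hw; have := heis 0 p w.
  by rewrite hw Y0r subr0 mul0r scale0r if_same.
Qed.

Let L : set C := [set 2 * k * n.+1%:R | n in [set: nat]].

Let L_add a b : L a -> L b -> L (a + b).
Proof.
move=> [n _ <-] [m _ <-]; rewrite -mulrDr -natrD.
by exists (n + m).+1 => //; congr (_ * _%:R); lia.
Qed.

Let L_create u (n : nat) : [set x] u -> exists2 b, L b & forall w,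
  D (Y u (- n.+1%:Z) w) = Y u (- n.+1%:Z) (D w) + b *: Y u (- n.+1%:Z) w.
Proof.
move=> ->; exists (2 * k * n.+1%:R); first by exists n.
by move=> w; rewrite heis_weight mulrNz mulrN scaleNr opprK.
Qed.

Let D_vac : D (vac V) = 0. Proof. exact: (Y_vac_ge0 _ 1). Qed.

Hypothesis k_neq0 : k != 0.

Let k2 : 2 * k != 0. Proof. by rewrite mulf_neq0 // pnatr_eq0. Qed.

(** A nonzero vector of lowest degree in J would be killed by every x_i with
    i > 0, and by x_0; then D kills it, so it has degree 0 and is proportional to
    the vacuum. *)
Lemma heis_simple (J : set V) : is_subspace J -> J `<=` S ->
  (forall n v, J v -> J (Y x n v)) -> ~ J (vac V) -> forall v, J v -> v = 0.
Proof.
move=> sJ JS xJ J1.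
have DJ v : J v -> J (D v).
  move=> Jv; rewrite -[D v](subrK (Y x 0 (Y x 0 v))); apply: (subspaceD sJ).
    by apply: heis_square_mod => // n; apply: xJ.
  exact/xJ/xJ.
have L0 : ~ L 0.
  move=> [n _ /eqP]; rewrite mulf_eq0 (negPf k2) pnatr_eq0 //=.
pose L' : set C := [set 2 * k * n%:R | n in [set: nat]].
have SL' v : S v -> eigsum D L' v.
  move=> Sv; have [c hc] := va_gen_grading heis_scalar D_vac L_add L_create Sv.
  rewrite -[v](subrK (c *: vac V)); apply: (subspaceD (eigsum_subspace _ _)).
    by apply: eigsum_sub hc => _ [n _ <-]; exists n.+1.
  apply: (@eigsum_eigen _ _ _ L' 0); first by exists 0%N; rewrite ?mulr0.
  by rewrite scale0r /= YZr D_vac scaler0.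
have wt n v : J v -> D v = (2 * k * n%:R) *: v -> v = 0.
  elim/ltn_ind: n v => -[|n] IH v Jv Dv.
    have [] := va_gen_weight0 heis_scalar D_vac L_add L_create L0 (JS _ Jv).
      by rewrite /= Dv mulr0 scale0r.
    move=> c vE; apply: contrapT => v0; apply: J1.
    have c0 : c != 0 by apply/eqP => c0; apply: v0; rewrite vE c0 scale0r.
    rewrite -[vac V]scale1r -(mulVf c0) -scalerA -vE; exact: subspaceZ.
  have xv (i : nat) : Y x i.+1 v = 0.
    have Jx := xJ i.+1 _ Jv.
    have Dx : D (Y x i.+1 v) = (2 * k * (n%:R - i%:R)) *: Y x i.+1 v.
      rewrite heis_weight Dv YZr -scalerBl; congr (_ *: _).
      rewrite -[_.+1%:~R]natr1 -[n.+1%:R]natr1; ring.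
    have [lein|ltni] := leqP i n.
      by apply: (IH (n - i)%N) => //; [lia|rewrite natrB].
    apply: (eigsum_eq0 (SL' _ (JS _ Jx)) Dx) => -[m _].
    move/(mulfI k2)/eqP; rewrite -subr_eq0 opprB addrA -natrD subr_eq0 eqr_nat.
    lia.
  have Dv0 : D v = 0.
    have : [set 0] (D v - Y x 0 (Y x 0 v)).
      apply: heis_square_mod => //; first exact: subspace_set0.
      by move=> m w /= ->; rewrite Y0r.
    by rewrite /= (heis_charge0 (JS _ Jv)) Y0r subr0.
  move/eqP: Dv; rewrite Dv0 eq_sym scaler_eq0 mulf_eq0 (negPf k2) pnatr_eq0.
  by move/eqP.
move=> v Jv; apply: (@eigsum_ind _ _ D L' J [set 0]) => //.
- exact: subspace_set0.
- by move=> _ u [n _ <-] Ju Du; apply: (wt n).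
- by apply: SL'; apply: JS.
Qed.
End Heisenberg.

(** * Free fields with scalar operator product *)

Section Bracket.
Variables (C : numFieldType) (V : vertexAlgType C).
Implicit Types (x y u v w : V).

Definition bracket x y (c : C) := forall (p q : int) w,
  Y x p (Y y q w) - Y y q (Y x p w) = if p + q == -1 then c *: w else 0.

Lemma bracketE x y c p q w : bracket x y c ->
  Y x p (Y y q w) = Y y q (Y x p w) + (if p + q == -1 then c else 0) *: w.
Proof.
move=> /(_ p q w) /eqP; rewrite subr_eq addrC => /eqP ->; congr (_ + _).
by case: ifP; rewrite ?scale0r.
Qed.

Lemma bracket_sym x y c : bracket x y c -> bracket y x (- c).
Proof.
move=> h p q w; rewrite -opprB h addrC.
by case: ifP; rewrite ?oppr0 ?scaleNr.
Qed.

Lemma bracketDl x x' y c c' : bracket x y c -> bracket x' y c' ->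
  bracket (x + x') y (c + c').
Proof.
move=> h h' p q w; rewrite !YDl YDr opprD addrACA h h'.
by case: ifP; rewrite ?addr0 ?scalerDl.
Qed.

Lemma bracketZl a x y c : bracket x y c -> bracket (a *: x) y (a * c).
Proof.
move=> h p q w; rewrite !YZl YZr -scalerBr h.
by case: ifP; rewrite ?scaler0 ?scalerA.
Qed.

Lemma bracketDr x x' y c c' : bracket y x c -> bracket y x' c' ->
  bracket y (x + x') (c + c').
Proof.
move=> /bracket_sym h /bracket_sym h'.
by rewrite -[c + c']opprK opprD; apply/bracket_sym/bracketDl.
Qed.

Lemma bracketZr a x y c : bracket y x c -> bracket y (a *: x) (a * c).
Proof.
move=> /bracket_sym h; rewrite -[a * c]opprK -mulrN.
exact/bracket_sym/bracketZl.
Qed.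

Lemma bracket_ope x y c (n : nat) : bracket x y c ->
  Y x n y = (n == 0%N)%:R *: (c *: vac V).
Proof.
move=> h; rewrite -{1}[y]Y_vacrN1 (bracketE _ _ _ h) Y_vac_ge0 Y0r add0r scalerA.
have -> : (n%:Z + -1 == -1) = (n == 0%N) by lia.
by case: eqP; rewrite ?mul1r ?mul0r.
Qed.

Lemma bracket0_modes x y p q w : bracket x y 0 ->
  Y x p (Y y q w) = Y y q (Y x p w).
Proof. by move=> /bracketE ->; rewrite if_same scale0r addr0. Qed.

Lemma bracket0_commuting x y : bracket x y 0 -> commuting x y.
Proof. by move=> h n; rewrite (bracket_ope _ h) scale0r scaler0. Qed.

Lemma bracket_create x y c (m n : nat) w : bracket x y c ->
  Y x (- m.+1%:Z) (Y y (- n.+1%:Z) w) = Y y (- n.+1%:Z) (Y x (- m.+1%:Z) w).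
Proof.
move=> h; rewrite (bracketE _ _ _ h).
have -> : (- m.+1%:Z + - n.+1%:Z == -1) = false by lia.
by rewrite scale0r addr0.
Qed.

Lemma current_action x u c (n p : int) w :
  (forall k : nat, Y x k u = (k == 0%N)%:R *: (c *: x)) ->
  Y u n (Y x p w) = Y x p (Y u n w) - c *: Y x (n + p) w.
Proof.
move=> h; have := @Y_commutator _ _ x u w p n 1; rewrite big_ord1 h scale1r.
rewrite zbin0 scale1r YZl subr0 [p + n]addrC => <- => [|[|k] // _].
  by rewrite opprB addrC subrK.
by rewrite h scale0r.
Qed.
End Bracket.

(** * Quadratic vectors in free fields and the Sugawara identity *)

Section Weyl.
Variables (C : numFieldType) (V : vertexAlgType C) (m : nat) (ap am : 'I_m -> V).
Hypothesis wpm : forall i j, bracket (ap i) (am j) (i == j)%:R.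
Hypothesis wpp : forall i j, bracket (ap i) (ap j) 0.
Hypothesis wmm : forall i j, bracket (am i) (am j) 0.
Implicit Types (i j k t : 'I_m) (P : pred 'I_m).

Let wmp i j : bracket (am i) (ap j) (- (i == j)%:R).
Proof. by rewrite eq_sym; apply: bracket_sym. Qed.

Definition quad i j : V := Y (ap i) (-1) (am j).
Definition number P : V := \sum_(i | P i) quad i i.

Lemma quad_comm i j : Y (am j) (-1) (ap i) = quad i j.
Proof.
rewrite /quad -{1}[ap i]Y_vacrN1 -{2}[am j]Y_vacrN1; symmetry.
exact: (bracket_create 0 0 _ (wpm i j)).
Qed.

Lemma ap_quad i k t (n : nat) : Y (ap i) n (quad k t) = ((n == 0%N) && (i == t))%:R *: ap k.
Proof.
rewrite /quad (bracket0_modes _ _ _ (wpp i k)) (bracket_ope _ (wpm i t)) scalerA.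
by rewrite YZr Y_vacrN1 -natrM mulnb.
Qed.

Lemma am_quad j k t (n : nat) : Y (am j) n (quad k t) = - ((n == 0%N) && (j == k))%:R *: am t.
Proof.
rewrite /quad (bracketE _ _ _ (wmp j k)) (bracket_ope _ (wmm j t)) scale0r scaler0 Y0r.
rewrite add0r; have -> : (n%:Z + -1 == -1) = (n == 0%N) by lia.
by case: (n == 0%N); rewrite ?oppr0.
Qed.

Lemma ap_number P i (k : nat) : Y (ap i) k (number P) = (k == 0%N)%:R *: ((P i)%:R *: ap i).
Proof.
rewrite linear_sum /=; under eq_bigr do rewrite ap_quad.
case: (k == 0%N) => /=; last by rewrite scale0r big1 // => j _; rewrite scale0r.
rewrite scale1r big_mkcond (bigD1 i) //= big1 ?addr0 => [|j ji].
  by case: (P i); rewrite ?eqxx ?scale0r.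
by rewrite [i == j]eq_sym (negPf ji) scale0r if_same.
Qed.

Lemma am_number P i (k : nat) : Y (am i) k (number P) = (k == 0%N)%:R *: (- (P i)%:R *: am i).
Proof.
rewrite linear_sum /=; under eq_bigr do rewrite am_quad.
case: (k == 0%N) => /=; last by rewrite scale0r big1 // => j _; rewrite oppr0 scale0r.
rewrite scale1r big_mkcond (bigD1 i) //= big1 ?addr0 => [|j ji].
  by case: (P i); rewrite ?eqxx ?oppr0 ?scale0r.
by rewrite [i == j]eq_sym (negPf ji) oppr0 scale0r if_same.
Qed.

Lemma number_ap P i (n p : int) w : Y (number P) n (Y (ap i) p w) =
  Y (ap i) p (Y (number P) n w) - (P i)%:R *: Y (ap i) (n + p) w.
Proof. exact/current_action/ap_number. Qed.

Lemma number_am P i (n p : int) w : Y (number P) n (Y (am i) p w) =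
  Y (am i) p (Y (number P) n w) + (P i)%:R *: Y (am i) (n + p) w.
Proof. by rewrite (current_action _ _ _ (am_number P i)) scaleNr opprK. Qed.

Local Notation H := (number xpredT).

Lemma number_quad i j (n : nat) : Y H n (quad i j) = - ((n == 1%N) && (i == j))%:R *: vac V.
Proof.
rewrite /quad number_ap -{1}[am j]Y_vacrN1 number_am Y_vac_ge0 Y0r add0r !scale1r.
case: n => [|[|n]].
- by rewrite !add0r Y_vacrN1 subrr oppr0 scale0r.
- have := bracket_ope 0 (wpm i j); rewrite /= scale1r => ->.
  by rewrite (Y_vac_ge0 (am j) 0) Y0r add0r scaleNr.
- have -> : n.+2%:Z + -1 = n.+1%:Z by lia.
  by rewrite Y_vac_ge0 Y0r (bracket_ope _ (wpm i j)) /= oppr0 !scale0r subrr.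
Qed.

Lemma number_ope (n : nat) : Y H n H = - ((n == 1%N)%:R * m%:R) *: vac V.
Proof.
rewrite {2}/number linear_sum /=; under eq_bigr do rewrite number_quad eqxx andbT.
by rewrite sumr_const card_ord -scaler_nat scalerA mulrN mulrC.
Qed.

Lemma number_heis (p q : int) (w : V) : Y H p (Y H q w) - Y H q (Y H p w) =
  if p + q == 0 then (p%:~R * - m%:R) *: w else 0.
Proof.
rewrite (@Y_commutator _ _ H H w p q 2) => [|[|[|i]] // _].
  rewrite !big_ord_recl big_ord0 !number_ope /= mul0r oppr0 scale0r Y0l scaler0 add0r addr0.
  rewrite mul1r zbin1 YZl Y_vac scalerA.
  have -> : (p + q - (bump 0 0)%:Z == -1) = (p + q == 0) by rewrite /bump /=; lia.
  by case: ifP; rewrite ?scaler0.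
by rewrite number_ope mul0r oppr0 scale0r.
Qed.

(** This is -2 times the conformal vector for which all generators have weight
    1/2: the eigenvalue of its mode 1 is -2 times the weight. *)
Definition conformal : V := \sum_i (Y (ap i) (-2) (am i) - Y (am i) (-2) (ap i)).

Lemma ap_conformal j (n : nat) : Y (ap j) n conformal =
  if n == 0%N then Y (ap j) (-2) (vac V) else if n == 1%N then - ap j else 0.
Proof.
rewrite linear_sum /= (eq_bigr (fun i => (i == j)%:R *: Y (ap j) n
    (Y (ap j) (-2) (am j) - Y (am j) (-2) (ap j)))) => [|i _]; last first.
  case: eqP => [->|/eqP ij]; first by rewrite scale1r.
  rewrite scale0r YBr (bracket0_modes _ _ _ (wpp j i)) (bracket_ope _ (wpm j i)).
  rewrite (bracketE _ _ _ (wpm j i)) (bracket_ope _ (wpp j i)) [j == i]eq_sym (negPf ij).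
  by rewrite if_same !(scale0r, scaler0, Y0r, addr0, subr0).
rewrite (bigD1 j) //= eqxx scale1r big1 ?addr0 => [|i /negPf ->]; last by rewrite scale0r.
rewrite YBr (bracket0_modes _ _ _ (wpp j j)) (bracket_ope _ (wpm j j)).
rewrite (bracketE _ _ _ (wpm j j)) (bracket_ope _ (wpp j j)) eqxx.
rewrite !(scale0r, scaler0, Y0r, add0r).
case: n => [|[|n]] /=; first by rewrite !scale1r scale0r subr0.
  by rewrite !(scale0r, Y0r, scale1r, sub0r).
by rewrite !(scale0r, Y0r, subr0).
Qed.

Lemma am_conformal j (n : nat) : Y (am j) n conformal =
  if n == 0%N then Y (am j) (-2) (vac V) else if n == 1%N then - am j else 0.
Proof.
rewrite linear_sum /= (eq_bigr (fun i => (i == j)%:R *: Y (am j) n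
    (Y (ap j) (-2) (am j) - Y (am j) (-2) (ap j)))) => [|i _]; last first.
  case: eqP => [->|/eqP ij]; first by rewrite scale1r.
  rewrite scale0r YBr (bracket0_modes _ _ _ (wmm j i)) (bracket_ope _ (wmp j i)).
  rewrite (bracketE _ _ _ (wmp j i)) (bracket_ope _ (wmm j i)) [j == i]eq_sym (negPf ij).
  by rewrite oppr0 if_same !(scale0r, scaler0, Y0r, addr0, subr0).
rewrite (bigD1 j) //= eqxx scale1r big1 ?addr0 => [|i /negPf ->]; last by rewrite scale0r.
rewrite YBr (bracket0_modes _ _ _ (wmm j j)) (bracket_ope _ (wmp j j)).
rewrite (bracketE _ _ _ (wmp j j)) (bracket_ope _ (wmm j j)) eqxx.
rewrite !(scale0r, scaler0, Y0r, add0r).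
case: n => [|[|n]] /=.
- by rewrite scale1r !scaleN1r YNr opprK scale0r add0r.
- by rewrite !(scale0r, Y0r, scaleN1r, subr0).
by rewrite !(scale0r, Y0r, subr0).
Qed.

Lemma conformal_action x (p : int) w :
  (forall n : nat, Y x n conformal =
     if n == 0%N then Y x (-2) (vac V) else if n == 1%N then - x else 0) ->
  Y conformal 1 (Y x p w) = Y x p (Y conformal 1 w) + (2 * p%:~R + 1) *: Y x p w.
Proof.
move=> h; have := @Y_commutator _ _ x conformal w p 1 2.
rewrite !big_ord_recl big_ord0 !h /= zbin0 zbin1 scale1r YNl Y_deriv subr0 addr0.
rewrite addrK scalerN -scaleNr -scalerDl => hc.
rewrite -[LHS](subrK (Y x p (Y conformal 1 w))) addrC; congr (_ + _).
rewrite -[LHS]opprB hc => [|[|[|i]] // _].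
by rewrite -scaleNr; congr (_ *: _); rewrite rmorphD /=; ring.
Qed.

Lemma conformal_ap i (p : int) w :
  Y conformal 1 (Y (ap i) p w) = Y (ap i) p (Y conformal 1 w) + (2 * p%:~R + 1) *: Y (ap i) p w.
Proof. exact/conformal_action/ap_conformal. Qed.

Lemma conformal_am i (p : int) w :
  Y conformal 1 (Y (am i) p w) = Y (am i) p (Y conformal 1 w) + (2 * p%:~R + 1) *: Y (am i) p w.
Proof. exact/conformal_action/am_conformal. Qed.

Lemma quad_modeN1 i j k t : Y (quad i j) (-1) (quad k t) =
  Y (ap i) (-1) (Y (am j) (-1) (quad k t))
  - (j == k)%:R *: Y (ap i) (-2) (am t) + (i == t)%:R *: Y (am j) (-2) (ap k).
Proof.
rewrite {1}/quad (@Y_assocN1 _ _ _ _ _ _ 2); last 2 first.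
- by case=> [|n] // _; rewrite ap_quad scale0r.
- case=> [|[|n]] // _; have -> : -1 + n.+2%:Z = n.+1%:Z by lia.
  by rewrite am_quad oppr0 scale0r.
rewrite !big_ord_recl big_ord0 addr0 /= (ap_quad i k t 0) (ap_quad i k t 1).
rewrite (am_quad j k t 0) scale0r !Y0r !addr0 !YZr scaleNr addrAC.
by [].
Qed.

Lemma quad_mode0 i j k t : Y (quad i j) 0 (quad k t) =
  (i == t)%:R *: quad k j - (j == k)%:R *: quad i t.
Proof.
rewrite {1}/quad (@Y_assocN1 _ _ _ _ _ _ 1); last 2 first.
- by case=> [|n] // _; rewrite ap_quad scale0r.
- case=> [|n] // _; rewrite add0r.
  by rewrite am_quad oppr0 scale0r.
rewrite big_ord1 /= (ap_quad i k t 0) (am_quad j k t 0) /= !YZr scaleNr !subr0 addrC.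
by congr (_ *: _ - _); rewrite -quad_comm.
Qed.

(** The sign eps encodes the symplectic form on the span of the a_i^+, which
    pairs a_i^+ with a_{rev i}^+. *)
Variable eps : 'I_m -> C.
Hypothesis eps_sqr : forall i, eps i * eps i = 1.
Hypothesis eps_rev : forall i, eps (rev_ord i) = - eps i.

Definition sp_current i j : V := quad i j - (eps i * eps j) *: quad (rev_ord j) (rev_ord i).

(** The reindexing (i, j) -> (rev j, rev i) is the symplectic transposition: the
    [sp_current]s are its anti-invariants. *)
Lemma sum_rev2 (F : 'I_m -> 'I_m -> V) :
  \sum_i \sum_j F i j = \sum_i \sum_j F (rev_ord j) (rev_ord i).
Proof.
rewrite exchange_big /= (reindex_inj rev_ord_inj) /=.
by apply: eq_bigr => i _; rewrite (reindex_inj rev_ord_inj).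
Qed.

Let quart i j k t := Y (ap i) (-1) (Y (am j) (-1) (quad k t)).

Let quart_perm i j k t : quart i j k t = quart i t k j.
Proof.
rewrite /quart /quad; congr (Y _ _ _).
rewrite -{1}[am t]Y_vacrN1 -{2}[am j]Y_vacrN1.
rewrite (bracket_create 0 0 _ (wpm k t)) (bracket0_modes _ _ _ (wmm j t)).
by rewrite -(bracket_create 0 0 _ (wpm k j)).
Qed.

Let quart_perm' i j k t : quart i j k t = quart k j i t.
Proof.
rewrite /quart /quad.
rewrite (bracket_create 0 0 _ (wmp j k)) (bracket0_modes _ _ _ (wpp i k)).
by rewrite -(bracket_create 0 0 _ (wmp j i)).
Qed.

Let sumsq : Y H (-1) H = \sum_i \sum_j quart i i j j - conformal.
Proof.
rewrite {1}/number Y_suml /conformal -sumrB; apply: eq_bigr => i _.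
rewrite linear_sum /=; under eq_bigr do rewrite quad_modeN1.
rewrite !big_split /= sumrN -addrA; congr (_ + _).
rewrite opprB addrC; congr (_ - _).
all: rewrite (bigD1 i) //= eqxx scale1r big1 ?addr0 // => j ji.
all: by rewrite eq_sym (negPf ji) scale0r.
Qed.

(** The Casimir sum of gl: after reordering, its quartic terms are those of
    H_{-1} H, and each of the two contractions leaves a free index, hence the
    factor m. *)
Let casA : \sum_i \sum_j Y (quad i j) (-1) (quad j i) =
  Y H (-1) H + conformal - m%:R *: conformal.
Proof.
rewrite sumsq subrK.
under eq_bigr do under eq_bigr do rewrite quad_modeN1 !eqxx !scale1r -[Y (ap _) _ _](quart_perm _ _ _ _).
under eq_bigr do rewrite !big_split /= sumrN.
rewrite !big_split /= sumrN -addrA; congr (_ + _).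
rewrite [X in _ + X]exchange_big /= /conformal.
under eq_bigr do rewrite sumr_const card_ord.
under [X in _ + X]eq_bigr do rewrite sumr_const card_ord.
rewrite scaler_nat sumrB mulrnBl opprB addrC.
by rewrite !sumrMnl.
Qed.

(** The twisted sum has no quartic terms: eps changes sign under the exchange of
    a_i^+ and a_{rev i}^+, which commute.  Only contractions remain. *)
Let casB : \sum_i \sum_j (eps i * eps j) *: Y (quad i j) (-1) (quad (rev_ord i) (rev_ord j)) = conformal.
Proof.
have er i : eps i * eps (rev_ord i) = -1 by rewrite eps_rev mulrN eps_sqr.
pose Q := \sum_i \sum_j (eps i * eps j) *: quart i j (rev_ord i) (rev_ord j).
have Q0 : Q = 0.
  (* Exchange i and rev i. *)
  have QN : Q = - Q.
    rewrite {1}/Q (reindex_inj rev_ord_inj) /= -sumrN; apply: eq_bigr => i _.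
    rewrite -sumrN; apply: eq_bigr => j _.
    by rewrite eps_rev rev_ordK quart_perm' mulNr scaleNr.
  have /eqP : 2 *: Q = 0 by rewrite scaler_nat mulr2n {1}QN addNr.
  by rewrite scaler_eq0 pnatr_eq0 => /eqP.
have rowE i : \sum_j (eps i * eps j) *: Y (quad i j) (-1) (quad (rev_ord i) (rev_ord j)) =
   \sum_j (eps i * eps j) *: quart i j (rev_ord i) (rev_ord j)
   + (Y (ap i) (-2) (am i) - Y (am (rev_ord i)) (-2) (ap (rev_ord i))).
  under eq_bigr => j _ do rewrite quad_modeN1 scalerDr scalerBr.
  rewrite !big_split /= sumrN -addrA; congr (_ + (_ + _)).
    rewrite (bigD1 (rev_ord i)) //= eqxx er rev_ordK scale1r scaleN1r.
    rewrite big1 ?addr0 ?opprK // => j /negPf ->.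
    by rewrite scale0r scaler0.
  rewrite (bigD1 (rev_ord i)) //= rev_ordK eqxx er scale1r scaleN1r.
  rewrite big1 ?addr0 // => j ji.
  have /negPf -> : i != rev_ord j by apply: contraNneq ji => ->; rewrite rev_ordK.
  by rewrite scale0r scaler0.
rewrite (eq_bigr _ (fun i _ => rowE i)) big_split /= -/Q Q0 add0r /conformal !sumrB.
by congr (_ - _); rewrite [RHS](reindex_inj rev_ord_inj).
Qed.

Lemma casimir : \sum_i \sum_j Y (sp_current i j) (-1) (sp_current j i) =
  2 *: Y H (-1) H - (2 * m%:R) *: conformal.
Proof.
pose A i j := Y (quad i j) (-1) (quad j i).
pose B i j := (eps i * eps j) *: Y (quad i j) (-1) (quad (rev_ord i) (rev_ord j)).
have -> : \sum_i \sum_j Y (sp_current i j) (-1) (sp_current j i) =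
   \sum_i \sum_j (A i j + A (rev_ord j) (rev_ord i) - (B i j + B (rev_ord j) (rev_ord i))).
  apply: eq_bigr => i _; apply: eq_bigr => j _.
  rewrite /sp_current /A /B !YBl !YBr !YZl !YZr !rev_ordK !eps_rev scalerA.
  rewrite [eps j * eps i]mulrC mulrACA !eps_sqr mulr1 scale1r mulrNN.
  rewrite [eps j * eps i]mulrC opprB opprD -!addrA; congr (_ + _).
  by rewrite addrC -!addrA [X in _ = _ + X]addrC.
rewrite (eq_bigr (fun i => \sum_j A i j + \sum_j A (rev_ord j) (rev_ord i)
  - (\sum_j B i j + \sum_j B (rev_ord j) (rev_ord i)))) => [|i _]; last first.
  by rewrite sumrB !big_split.
rewrite sumrB !big_split /= -!sum_rev2 casA casB -!mulr2n -!scaler_nat.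
by rewrite scalerBr scalerDr scalerA addrAC addrK.
Qed.
End Weyl.

(** * Diagonalization on the Weyl vertex algebra *)

Section WeylTheory.
Variables (C : numFieldType) (V : vertexAlgType C) (m : nat) (ap am : 'I_m -> V).
Hypothesis weylV : is_weyl ap am.

Lemma weyl_bracket_pm i j : bracket (ap i) (am j) (i == j)%:R.
Proof.
move=> p q w; rewrite (weyl_pm weylV).
by case: (p + q == -1) => //=; case: eqP; rewrite ?scale1r ?scale0r.
Qed.

Lemma weyl_bracket_pp i j : bracket (ap i) (ap j) 0.
Proof. by move=> p q w; rewrite (weyl_pp weylV) subrr scale0r if_same. Qed.

Lemma weyl_bracket_mm i j : bracket (am i) (am j) 0.
Proof. by move=> p q w; rewrite (weyl_mm weylV) subrr scale0r if_same. Qed.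

Let X : set V := [set u | exists i, u = ap i \/ u = am i].

(** By irreducibility, as the generated subalgebra contains the vacuum. *)
Let va_gen_weyl v : va_gen X v.
Proof.
have [sX X1 cX] := va_gen_subva X.
have [|X0|->//] := weyl_irr weylV sX.
  move=> i p w Xw; split; apply: cX => //; apply: sub_va_gen; exists i; by [left|right].
by have := weyl_neq0 weylV; rewrite X0 /= in X1.
Qed.

Let scX : scalar_commuting X.
Proof.
move=> u v [i ui] [j vj] p q.
have [c hc] : exists c, bracket u v c.
  case: ui => ->; case: vj => ->; eexists.
  - exact: weyl_bracket_pp.
  - exact: weyl_bracket_pm.
  - exact/bracket_sym/weyl_bracket_pm.
  - exact: weyl_bracket_mm.
by eexists => w; apply: (bracketE _ _ _ hc).
Qed.

Definition nat_opp : set C := [set - n%:R | n in [set: nat]].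

Lemma conformal_nonpos v : eigsum (Y (conformal ap am) 1) nat_opp v.
Proof.
have [|||c hc] := va_gen_grading (D := Y (conformal ap am) 1) (L := nat_opp) scX _ _ _ (va_gen_weyl v).
- exact: (Y_vac_ge0 _ 1).
- by move=> _ _ [n _ <-] [k _ <-]; exists (n + k)%N => //; rewrite natrD opprD.
- move=> u n Xu; exists (2 * (- n.+1%:Z)%:~R + 1).
    exists (2 * n + 1)%N => //; rewrite natrD natrM mulrNz -[n.+1%:~R]natr1; ring.
  by move=> w; case: Xu => i [] ->; [apply: conformal_ap|apply: conformal_am];
    solve [exact: weyl_bracket_pp|exact: weyl_bracket_pm|exact: weyl_bracket_mm].
rewrite -[v](subrK (c *: vac V)); apply: (subspaceD (eigsum_subspace _ _)) => //.
apply: (@eigsum_eigen _ _ _ _ 0); first by exists 0%N; rewrite ?oppr0.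
by rewrite /= YZr (Y_vac_ge0 _ 1) scaler0 scale0r.
Qed.

Lemma conformal_weight0 v : Y (conformal ap am) 1 v = 0 -> exists c, v = c *: vac V.
Proof.
move=> hv; apply: (va_gen_weight0 (D := Y (conformal ap am) 1)
  (L := [set - n.+1%:R | n in [set: nat]]) scX _ _ _ _ (va_gen_weyl v)) => //=.
- exact: (Y_vac_ge0 _ 1).
- move=> _ _ [n _ <-] [k _ <-]; exists (n + k).+1 => //.
  by rewrite -opprD -natrD; congr (- _%:R); lia.
- move=> u n Xu; exists (2 * (- n.+1%:Z)%:~R + 1).
    exists (2 * n)%N => //; rewrite mulrNz -[n.+1%:~R]natr1 -natr1 natrM; ring.
  by move=> w; case: Xu => i [] ->; [apply: conformal_ap|apply: conformal_am];
    solve [exact: weyl_bracket_pp|exact: weyl_bracket_pm|exact: weyl_bracket_mm].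
- by move=> [n _ /eqP]; rewrite oppr_eq0 pnatr_eq0.
Qed.

Definition int_set : set C := [set n%:~R | n in [set: int]].

Lemma charge_int v : eigsum (Y (number ap am xpredT) 0) int_set v.
Proof.
have vac0 : Y (number ap am xpredT) 0 (vac V) = 0 by exact: (Y_vac_ge0 _ 0).
have [|||c hc] := va_gen_grading (D := Y (number ap am xpredT) 0) (L := int_set) scX _ _ _ (va_gen_weyl v).
- exact: vac0.
- by move=> _ _ [n _ <-] [k _ <-]; exists (n + k) => //; rewrite rmorphD.
- move=> u n [i [] ->]; [exists (-1)|exists 1].
  + by exists (-1).
  + move=> w; rewrite /= number_ap => [||j k]; last exact: weyl_bracket_pp.
      by rewrite add0r scale1r scaleN1r.
    exact: weyl_bracket_pm.
  + by exists 1.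
  + move=> w; rewrite /= number_am => [||j k]; last exact: weyl_bracket_mm.
      by rewrite add0r !scale1r.
    exact: weyl_bracket_pm.
rewrite -[v](subrK (c *: vac V)); apply: (subspaceD (eigsum_subspace _ _)) => //.
apply: (@eigsum_eigen _ _ _ _ 0); first by exists 0.
by rewrite /= YZr vac0 scaler0 scale0r.
Qed.
End WeylTheory.

Section Signature.
Variables (C : numClosedFieldType) (l : nat).
Implicit Type i : 'I_(2 * l).

Definition sgn i : C := if (i < l)%N then 1 else -1.

Lemma sgn_sqr i : sgn i * sgn i = 1.
Proof. by rewrite /sgn; case: ifP; rewrite ?mulr1 ?mulrNN ?mulr1. Qed.

Lemma rev_ord_lt i : (rev_ord i < l)%N = (l <= i)%N.
Proof. have := ltn_ord i; rewrite /=; lia. Qed.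

Lemma sgn_rev i : sgn (rev_ord i) = - sgn i.
Proof. by rewrite /sgn rev_ord_lt leqNgt; case: (i < l)%N => /=; rewrite ?opprK. Qed.

End Signature.

(** * The commutant of the affine vertex algebra *)

Section Commutant.
Variables (C : numClosedFieldType) (l : nat) (V : vertexAlgType C).
Variables ap am : 'I_(2 * l) -> V.
Hypothesis l_gt0 : (0 < l)%N.
Hypothesis weylV : is_weyl ap am.
Implicit Types i j k t : 'I_(2 * l).

Let wpm := weyl_bracket_pm weylV.
Let wpp := weyl_bracket_pp weylV.
Let wmm := weyl_bracket_mm weylV.

Local Notation sgn := (@sgn C l).
Local Notation J := (sp_current ap am sgn).
Local Notation H := (weyl_H ap am).
Local Notation S := (va_gen [set H]).

Lemma weyl_HE : H = number ap am xpredT. Proof. by []. Qed.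

Lemma sp_current_rev i j : J (rev_ord j) (rev_ord i) = - (sgn i * sgn j) *: J i j.
Proof.
rewrite /sp_current !rev_ordK !sgn_rev mulrNN scalerBr scalerA mulNr mulrACA !sgn_sqr.
by rewrite mulr1 scaleN1r opprK addrC scaleNr [sgn j * _]mulrC.
Qed.

Let half (u v : V) : u + u = v -> u = 2^-1 *: v.
Proof.
move=> <-; rewrite -mulr2n -scaler_nat scalerA mulVf ?scale1r //.
by rewrite pnatr_eq0.
Qed.

Lemma e_longE i : (i < l)%N -> e_long ap am i = 2^-1 *: J i (rev_ord i).
Proof.
move=> il; apply: half; rewrite /sp_current rev_ordK sgn_rev mulrN sgn_sqr scaleN1r opprK.
by [].
Qed.

Lemma f_longE i : (i < l)%N -> f_long ap am i = 2^-1 *: J (rev_ord i) i.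
Proof.
move=> il; apply: half; rewrite /sp_current rev_ordK sgn_rev mulNr sgn_sqr scaleN1r opprK.
by rewrite /f_long (quad_comm wpm).
Qed.

Lemma e_sumE i j : (i < j < l)%N -> e_sum ap am i j = 2^-1 *: J i (rev_ord j).
Proof.
move=> /andP[ij jl]; rewrite /e_sum /sp_current rev_ordK sgn_rev /sgn jl (ltn_trans ij jl).
by rewrite mulrN mulr1 scaleN1r opprK.
Qed.

Lemma f_sumE i j : (i < j < l)%N -> f_sum ap am i j = 2^-1 *: J (rev_ord j) i.
Proof.
move=> /andP[ij jl]; rewrite /f_sum /sp_current rev_ordK sgn_rev /sgn jl (ltn_trans ij jl).
by rewrite mulr1 scaleN1r opprK !(quad_comm wpm).
Qed.

Lemma e_diffE i j : (i < j < l)%N -> e_diff ap am i j = 2^-1 *: J i j.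
Proof.
move=> /andP[ij jl]; rewrite /e_diff /sp_current /sgn jl (ltn_trans ij jl).
by rewrite mulr1 scale1r.
Qed.

Lemma f_diffE i j : (i < j < l)%N -> f_diff ap am i j = 2^-1 *: J j i.
Proof.
move=> /andP[ij jl]; rewrite /f_diff /sp_current /sgn jl (ltn_trans ij jl).
by rewrite mulr1 scale1r.
Qed.

Let LCs : is_subspace (LC ap am). Proof. by case: (va_gen_subva (LC_gens ap am)). Qed.

Let LC_double u v : LC_gens ap am u -> u = 2^-1 *: v -> LC ap am v.
Proof.
move=> Gu uE; have -> : v = 2 *: u by rewrite uE scalerA mulfV ?scale1r // pnatr_eq0.
by apply: (subspaceZ LCs); apply: sub_va_gen.
Qed.

(** Up to scalars, the root vectors are the currents with i and j distinct.  The
    diagonal currents, which span the Cartan subalgebra, are commutators of the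
    long root vectors e and f. *)
Lemma LC_sp_current i j : LC ap am (J i j).
Proof.
have rev_i i' j' : LC ap am (J (rev_ord j') (rev_ord i')) -> LC ap am (J i' j').
  move=> h; rewrite -[J i' j']scale1r -(mulr1 1) -[X in X * _](sgn_sqr C i') -(sgn_sqr C j').
  rewrite mulrACA -mulrNN -scalerA -sp_current_rev.
  exact: (subspaceZ LCs).
have diff i' j' : (i' < l)%N -> (j' < l)%N -> LC ap am (J i' j').
  move=> il jl; case: (ltngtP i' j') => ij.
  - apply: (@LC_double (e_diff ap am i' j')); last by apply: e_diffE; rewrite ij jl.
    by right; exists i', j'; rewrite ij jl; split=> //; constructor 3.
  - apply: (@LC_double (f_diff ap am j' i')); last by apply: f_diffE; rewrite ij il.
    by right; exists j', i'; rewrite ij il; split=> //; constructor 4.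
  - have -> : j' = i' by apply: val_inj.
    have -> : J i' i' = - Y (e_long ap am i') 0 (f_long ap am i').
      rewrite /f_long (quad_comm wpm) (quad_mode0 wpm wpp wmm) !eqxx !scale1r opprB.
      by rewrite /sp_current sgn_sqr scale1r.
    apply: (subspaceN LCs); apply: (subva_closed _ (va_gen_subva _)); apply: sub_va_gen.
      by left; exists i' => //; left.
    by left; exists i' => //; right.
have sumE i' j' : (i' < l)%N -> (j' < l)%N -> LC ap am (J i' (rev_ord j')).
  move=> il jl; wlog ij : i' j' il jl / (i' <= j')%N => [hw|].
    case: (leqP i' j') => ij; first exact: hw.
    by apply: rev_i; rewrite rev_ordK; apply: hw => //; apply: ltnW.
  move: ij; rewrite leq_eqVlt => /orP[/eqP ij|ij].
  - have <- : i' = j' by apply: val_inj.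
    apply: (@LC_double (e_long ap am i')); last exact: e_longE.
    by left; exists i' => //; left.
  - apply: (@LC_double (e_sum ap am i' j')); last by apply: e_sumE; rewrite ij jl.
    by right; exists i', j'; rewrite ij jl; split=> //; constructor 1.
have sumF i' j' : (i' < l)%N -> (j' < l)%N -> LC ap am (J (rev_ord j') i').
  move=> il jl; wlog ij : i' j' il jl / (i' <= j')%N => [hw|].
    case: (leqP i' j') => ij; first exact: hw.
    by apply: rev_i; rewrite rev_ordK; apply: hw => //; apply: ltnW.
  move: ij; rewrite leq_eqVlt => /orP[/eqP ij|ij].
  - have <- : i' = j' by apply: val_inj.
    apply: (@LC_double (f_long ap am i')); last exact: f_longE.
    by left; exists i' => //; right.
  - apply: (@LC_double (f_sum ap am i' j')); last by apply: f_sumE; rewrite ij jl.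
    by right; exists i', j'; rewrite ij jl; split=> //; constructor 2.
case: (ltnP i l) => il; case: (ltnP j l) => jl.
- exact: diff.
- by rewrite -(rev_ordK j); apply: sumE; rewrite ?rev_ord_lt.
- by rewrite -(rev_ordK i); apply: sumF; rewrite ?rev_ord_lt.
- by apply: rev_i; apply: diff; rewrite rev_ord_lt.
Qed.

(** The only possible obstruction is the second order pole, a trace, which
    vanishes on the symplectic Lie algebra. *)
Lemma weyl_H_sp_current i j : commuting H (J i j).
Proof.
move=> n; rewrite YBr YZr weyl_HE !(number_quad wpm wpp wmm) (inj_eq rev_ord_inj).
rewrite scalerA mulrN [j == i]eq_sym; case: (i =P j) => [->|_].
  by rewrite sgn_sqr mul1r subrr.
by rewrite andbF mulr0 oppr0 scale0r subrr.
Qed.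

Lemma LC_gens_commuting u : LC_gens ap am u -> commuting H u.
Proof.
have hJ i j : commuting H (2^-1 *: J i j).
  by move=> n; rewrite YZr weyl_H_sp_current scaler0.
case=> [[i il []] -> | [i [j [ij []]]] ->].
- by rewrite e_longE.
- by rewrite f_longE.
- by rewrite e_sumE.
- by rewrite f_sumE.
- by rewrite e_diffE.
- by rewrite f_diffE.
Qed.

Let K := com (LC ap am) setT.

Lemma heis_com v : S v -> K v.
Proof.
move=> Sv; split=> // u LCu; apply: (va_gen_commuting _ LCu Sv) => {u LCu v Sv} u v hu ->.
exact/commuting_sym/LC_gens_commuting.
Qed.

Let k : C := - (2 * l)%:R.

Let k_neq0 : k != 0.
Proof. by rewrite oppr_eq0 pnatr_eq0 muln_eq0 -lt0n l_gt0. Qed.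

Lemma weyl_H_heis (p q : int) (w : V) : Y H p (Y H q w) - Y H q (Y H p w) =
  if p + q == 0 then (p%:~R * k) *: w else 0.
Proof. exact: number_heis. Qed.

Local Notation D := (Y (square H) 1).
Local Notation P := (Y (conformal ap am) 1).

(** The Casimir vector is in the affine subalgebra, so its nonnegative modes kill
    the commutant. *)
Lemma sugawara v : K v -> D v = - k *: P v.
Proof.
move=> [_ Kv]; have := casimir wpm wpp wmm (@sgn_sqr C l) (@sgn_rev C l).
set cas := \sum_i _; move=> casE.
have : Y cas 1 v = 0.
  apply: (Kv cas _ 1%N); apply: (subspace_sum LCs) => i _; apply: (subspace_sum LCs) => j _.
  by apply: (subva_closed _ (va_gen_subva _)); apply: LC_sp_current.
rewrite casE YBl !YZl -scalerA -scalerBr => /eqP.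
by rewrite scaler_eq0 pnatr_eq0 /= subr_eq0 opprK => /eqP.
Qed.

Let K_subva : is_subva K := com_setT_subva _.
Let K_H : K H. Proof. by apply: heis_com; apply: sub_va_gen. Qed.
Let S_subva := va_gen_subva [set H].
Let Ss : is_subspace S. Proof. by case: S_subva. Qed.
Let S_H n v : S v -> S (Y H n v).
Proof. by move=> Sv; apply: (subva_closed _ S_subva) => //; apply: sub_va_gen. Qed.
Let Ks : is_subspace K. Proof. by case: K_subva. Qed.

Lemma com_conformal v : K v -> K (P v).
Proof.
move=> Kv; have -> : P v = (- k)^-1 *: D v.
  by rewrite sugawara // scalerA mulVf ?scale1r // oppr_eq0.
by apply: (subspaceZ Ks); do 2?apply: (subva_closed _ K_subva) => //.
Qed.

(** Induction on the degree n.  All H_i v with i > 0 are in S, so the Sugawara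
    formula determines (2 l n + H_0 H_0) v modulo S, and this operator is
    invertible on the eigenvectors of H_0. *)
Lemma com_eigen_heis n v : K v -> P v = - n%:R *: v -> S v.
Proof.
elim/ltn_ind: n v => -[|n] IH v Kv Pv.
  have [|c ->] := conformal_weight0 weylV (v := v); first by rewrite Pv oppr0 scale0r.
  by apply: (subspaceZ Ss); case: S_subva.
have Hv (i : nat) : S (Y H i.+1 v).
  have KHv : K (Y H i.+1 v) by apply: (subva_closed _ K_subva).
  have Pe : P (Y H i.+1 v) = (2 * i.+1%:R - n.+1%:R) *: Y H i.+1 v.
    have nk0 : - k != 0 by rewrite oppr_eq0.
    apply: (scalerI nk0); rewrite -sugawara // (heis_weight weyl_H_heis).
    rewrite sugawara // Pv !YZr !scalerA -scalerBl; congr (_ *: _).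
    by rewrite -[i.+1%:~R]/(i.+1%:R); ring.
  have [le|lt] := leqP (2 * i.+1)%N n.+1.
    apply: (IH (n.+1 - 2 * i.+1)%N) => //; first lia.
    by rewrite Pe natrB // opprB natrM.
  have -> : Y H i.+1 v = 0; last exact: (subspace0 Ss).
  apply: (eigsum_eq0 (conformal_nonpos weylV _) Pe) => -[t _ /eqP].
  by rewrite -subr_eq0 -opprD oppr_eq0 addrA -natrM -natrD subr_eq0 eqr_nat; lia.
have DS : S (D v - Y H 0 (Y H 0 v)) by apply: heis_square_mod.
have DE : D v = (k * n.+1%:R) *: v by rewrite sugawara // Pv scalerA mulrNN.
rewrite DE in DS.
have := charge_int weylV v.
apply: (@eigsum_ind _ _ _ _ [set w | S ((k * n.+1%:R) *: w - Y H 0 (Y H 0 w))]) => //=.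
- split=> [|c u w] /=.
    by rewrite scaler0 !Y0r subr0; exact: (subspace0 Ss).
  move=> hu hw; rewrite !YDr !YZr scalerDr scalerA [_ * c]mulrC -[(c * _) *: u]scalerA opprD addrACA -scalerBr.
  by case: Ss => _; apply.
- by move=> u hu; rewrite -YZr -YBr; apply: S_H.
- move=> _ u [c _ <-] + Hu; rewrite -weyl_HE in Hu *.
  rewrite Hu YZr Hu scalerA -scalerBl => hS.
  (* Up to sign this is 2 l n + c ^ 2, with c an integer. *)
  have c0 : k * n.+1%:R - c%:~R * c%:~R != 0.
    rewrite -oppr_eq0 opprB /k mulNr opprK -natrM -intrM.
    rewrite -[_%:R]/((2 * l * n.+1)%:Z%:~R) -intrD intr_eq0.
    have : 0 <= c * c by rewrite -expr2 sqr_ge0.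
    have : (0 < 2 * l * n.+1)%N by rewrite !muln_gt0 l_gt0.
    lia.
  by rewrite -[u]scale1r -(mulVf c0) -scalerA; apply: (subspaceZ Ss).
Qed.

Lemma com_LC_heis v : K v -> S v.
Proof.
move=> Kv; apply: (@eigsum_ind _ _ _ _ K S _ Ks _ Ss _ Kv (conformal_nonpos weylV v)).
- exact: com_conformal.
- by move=> _ u [n _ <-] Ku; apply: com_eigen_heis.
Qed.
End Commutant.

(** * The rotated generators *)

Section BracketPair.
Variables (C : numFieldType) (V : vertexAlgType C).

Lemma bracket_pair (x x' y y' : V) (a b e f c1 c2 c3 c4 : C) :
  bracket x y c1 -> bracket x y' c2 -> bracket x' y c3 -> bracket x' y' c4 ->
  bracket (a *: (x + e *: x')) (b *: (y + f *: y'))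
    (a * (b * (c1 + f * c2) + e * (b * (c3 + f * c4)))).
Proof.
move=> h1 h2 h3 h4; apply: bracketZl; apply: bracketDl; last apply: bracketZl.
  by apply: bracketZr; apply: bracketDr => //; apply: bracketZr.
by apply: bracketZr; apply: bracketDr => //; apply: bracketZr.
Qed.
End BracketPair.

Section Rotated.
Variables (C : numClosedFieldType) (l : nat) (V : vertexAlgType C).
Variables ap am : 'I_(2 * l) -> V.
Hypothesis weylV : is_weyl ap am.
Implicit Types i j : 'I_(2 * l).

Let wpm := weyl_bracket_pm weylV.
Let wpp := weyl_bracket_pp weylV.
Let wmm := weyl_bracket_mm weylV.
Let wmp i j : bracket (am i) (ap j) (- (i == j)%:R).
Proof. by rewrite eq_sym; exact: bracket_sym (wpm j i). Qed.

Local Notation r2 := (sqrtC 2 : C).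
Let r2_sqr : r2 * r2 = 2. Proof. by rewrite -expr2 sqrtCK. Qed.
Let r2V : r2^-1 * r2^-1 = 2^-1. Proof. by rewrite -invfM r2_sqr. Qed.

(** Both families b^+ and b^- have the shape c (u_j + e u'_{rev j}) with j < l,
    where j is [low i] and e is a sign, so that the commutation relations need no
    case analysis on the positions of the indices. *)
Let low i := if (i < l)%N then i else rev_ord i.
Let cp i : C := if (i < l)%N then r2^-1 else 'i / r2.
Let cm i : C := if (i < l)%N then r2^-1 else - 'i / r2.

Let low_lt i : (low i < l)%N.
Proof. by rewrite /low; case: (ltnP i l) => // il; rewrite rev_ord_lt. Qed.

Let low_rev i j : (low i == rev_ord (low j)) = false.
Proof.
apply/eqP => /(congr1 (@nat_of_ord _)) h; have := low_lt i.
by rewrite h rev_ord_lt leqNgt low_lt.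
Qed.

Let bpE i : bp ap am i = cp i *: (ap (low i) + sgn C i *: am (rev_ord (low i))).
Proof.
rewrite /bp /cp /low /sgn; case: ifP => _; first by rewrite scale1r.
by rewrite rev_ordK scaleN1r.
Qed.

Let bmE i : bm ap am i = cm i *: (am (low i) + - sgn C i *: ap (rev_ord (low i))).
Proof.
rewrite /bm /cm /low /sgn; case: ifP => _; first by rewrite scaleN1r.
by rewrite rev_ordK opprK scale1r.
Qed.

Lemma rotated_pm i j : bracket (bp ap am i) (bm ap am j) (i == j)%:R.
Proof.
rewrite bpE bmE; set c := (X in bracket _ _ X).
suff -> : c = cp i * (cm j * ((low i == low j)%:R + - sgn C j * 0)
  + sgn C i * (cm j * (0 + - sgn C j * - (rev_ord (low i) == rev_ord (low j))%:R))).
  by apply: bracket_pair; [exact: wpm|exact: wpp|exact: wmm|exact: wmp].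
rewrite /c (inj_eq rev_ord_inj) mulr0 addr0 add0r mulrNN.
have [->|ij] := eqVneq i j.
  rewrite eqxx !mulr1 mulrCA sgn_sqr mulr1 -mulr2n.
  rewrite -[cm j *+ 2]mulr_natr mulrA /cp /cm; case: ifP => _.
    by rewrite r2V mulVf // pnatr_eq0.
  rewrite mulrACA r2V mulrN -expr2 sqrCi opprK mul1r mulVf //.
  by rewrite pnatr_eq0.
have [lij|_] := eqVneq (low i) (low j); last by rewrite !(mulr0, addr0).
have -> : sgn C i = - sgn C j.
  move: lij; rewrite /low; case: ifP => il; case: ifP => jl.
  - by move=> e; rewrite e eqxx in ij.
  - by move=> ->; rewrite sgn_rev.
  - by move=> <-; rewrite sgn_rev opprK.
  - by move/rev_ord_inj => e; rewrite e eqxx in ij.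
by rewrite !mulr1 mulNr mulrCA sgn_sqr mulr1 subrr mulr0.
Qed.

Lemma rotated_pp i j : bracket (bp ap am i) (bp ap am j) 0.
Proof.
rewrite !bpE; set c := (X in bracket _ _ X).
suff -> : c = cp i * (cp j * (0 + sgn C j * (low i == rev_ord (low j))%:R)
  + sgn C i * (cp j * (- (rev_ord (low i) == low j)%:R + sgn C j * 0))).
  by apply: bracket_pair; [exact: wpp|exact: wpm|exact: wmp|exact: wmm].
by rewrite [rev_ord _ == _]eq_sym !low_rev /c oppr0 !(mulr0, addr0).
Qed.

Lemma rotated_mm i j : bracket (bm ap am i) (bm ap am j) 0.
Proof.
rewrite !bmE; set c := (X in bracket _ _ X).
suff -> : c = cm i * (cm j * (0 + - sgn C j * - (low i == rev_ord (low j))%:R)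
  + - sgn C i * (cm j * ((rev_ord (low i) == low j)%:R + - sgn C j * 0))).
  by apply: bracket_pair; [exact: wmm|exact: wmp|exact: wpm|exact: wpp].
by rewrite [rev_ord _ == _]eq_sym !low_rev /c oppr0 !(mulr0, addr0).
Qed.

(** Every term has one factor in each tensor component of M. *)
Lemma weyl_H_rotated : weyl_H ap am = \sum_(i : 'I_(2 * l) | (i < l)%N)
  'i *: (Y (bp ap am i) (-1) (bm ap am (rev_ord i))
         - Y (bm ap am i) (-1) (bp ap am (rev_ord i))).
Proof.
rewrite /weyl_H (bigID (fun i : 'I_(2 * l) => (i < l)%N)) /=.
rewrite [X in _ + X](reindex_inj rev_ord_inj) /=.
rewrite [X in _ + X](eq_bigl (fun i : 'I_(2 * l) => (i < l)%N)); last first.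
  by move=> i; have := ltn_ord i; lia.
rewrite -big_split /=; apply: eq_bigr => i il.
have hi : (rev_ord i < l)%N = false by rewrite rev_ord_lt leqNgt il.
rewrite /bp /bm il hi rev_ordK !YZl !YZr scalerBr !scalerA.
have -> : 'i * (r2^-1 * (- 'i / r2)) = 2^-1.
  by rewrite mulrA mulrACA mulrN -expr2 sqrCi opprK mul1r r2V.
have -> : 'i * (r2^-1 * ('i / r2)) = - 2^-1.
  by rewrite mulrA mulrACA -expr2 sqrCi r2V mulN1r.
rewrite scaleNr opprK -scalerDr !(YDl, YDr, YNl, YNr) opprK.
have create (x y : V) c : bracket x y c -> Y x (-1) y = Y y (-1) x.
  move=> h; rewrite -{1}[y]Y_vacrN1 -{2}[x]Y_vacrN1.
  exact: (bracket_create 0 0 _ h).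
rewrite (create _ _ _ (wmp (rev_ord i) (rev_ord i))) (create _ _ _ (wmp i i)).
rewrite (create _ _ _ (wmm (rev_ord i) i)) (create _ _ _ (wpp (rev_ord i) i)).
set a := Y (ap i) (-1) (am i); set b := Y (ap (rev_ord i)) (-1) (am (rev_ord i)).
set c := Y (am i) (-1) _; set d := Y (ap i) (-1) (ap _).
have -> : a + d + (c + b) + (a - c + (- d + b)) = 2 *: (a + b).
  rewrite scaler_nat mulr2n [c + b]addrC [- d + b]addrC [a + d + _]addrACA [a - c + _]addrACA.
  by rewrite -opprD [d + c]addrC [LHS]addrACA subrr addr0.
by rewrite scalerA mulVf ?scale1r // pnatr_eq0.
Qed.
End Rotated.

(** * Parity in the tensor product *)

Section Signs.
Variables (C : numFieldType) (V : vertexAlgType C) (A : set V) (s : V -> V).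
Hypothesis sA : is_subva A.
Hypothesis s_aut : va_iso A A s.

Definition sgn_part (e : bool) : set V := [set v | A v /\ s v = (-1) ^+ e *: v].

Let As : is_subspace A. Proof. by case: sA. Qed.

Lemma aut_linear c u v : A u -> A v -> s (c *: u + v) = c *: s u + s v.
Proof. by case: s_aut => _ h _ _; apply: h. Qed.

Lemma sgn_part_subspace e : is_subspace (sgn_part e).
Proof.
split=> [|c u v [Au su] [Av sv]].
  split; first exact: (subspace0 As).
  have := aut_linear (-1) (subspace0 As) (subspace0 As).
  by rewrite !scaler0 addr0 scaleN1r addNr.
split; first by case: As => _; apply.
by rewrite aut_linear // su sv scalerDr !scalerA mulrC.
Qed.

Lemma sgn_part_vac : sgn_part false (vac V).
Proof. by split; [case: sA|case: s_aut => _ _ -> _; rewrite scale1r]. Qed.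

Lemma sgn_part_mode b e n v : A b -> s b = - b -> sgn_part e v ->
  sgn_part (~~ e) (Y b n v).
Proof.
move=> Ab sb [Av sv]; split; first exact: (subva_closed n sA).
case: s_aut => _ _ _ -> //; rewrite sb sv YNl YZr signrN scaleNr.
by [].
Qed.

Lemma sgn_part_eq e u v : sgn_part e u -> sgn_part (~~ e) v ->
  sgn_part e (u + v) -> v = 0.
Proof.
move=> hu [Av sv] huv.
have [_] : sgn_part e v.
  have -> : v = (u + v) - u by rewrite addrAC subrr add0r.
  exact: (subspaceB (sgn_part_subspace e)).
rewrite sv signrN scaleNr => /eqP; rewrite eq_sym -addr_eq0 -mulr2n -scaler_nat.
by rewrite scaler_eq0 pnatr_eq0 /= scaler_eq0 signr_eq0 => /eqP.
Qed.
End Signs.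

Section Tensor.
Variables (C : numClosedFieldType) (l : nat) (V : vertexAlgType C).
Variables ap am : 'I_(2 * l) -> V.
Hypothesis weylV : is_weyl ap am.
Local Notation b1 := (bset1 ap am).
Local Notation b2 := (bset2 ap am).
Local Notation A := (va_gen b1).
Local Notation B := (va_gen b2).
Variables s1 s2 : V -> V.
Hypothesis s1_aut : va_iso A A s1.
Hypothesis s1_sign : forall b, b1 b -> s1 b = - b.
Hypothesis s2_aut : va_iso B B s2.
Hypothesis s2_sign : forall b, b2 b -> s2 b = - b.

Let rpm := rotated_pm weylV.
Let rpp := rotated_pp weylV.
Let rmm := rotated_mm weylV.
Let Asub : is_subva A := va_gen_subva b1.
Let Bsub : is_subva B := va_gen_subva b2.

Lemma factors_commuting u v : A u -> B v -> commuting u v.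
Proof.
apply: va_gen_commuting => {}u {}v [i il iE] [j jl jE].
have ij : (i == j) = false by apply/eqP => e; rewrite e ltnNge jl in il.
apply: bracket0_commuting; case: iE => ->; case: jE => ->.
- exact: rpp.
- by have := rpm i j; rewrite ij.
- by have := bracket_sym (rpm j i); rewrite eq_sym ij oppr0.
- exact: rmm.
Qed.

Definition tensor_part (e : bool) : set V := va_tensor (sgn_part A s1 e) (sgn_part B s2 e).

Lemma tensor_part_subspace e : is_subspace (tensor_part e).
Proof. exact: lin_span_subspace. Qed.

Lemma tensor_fixed : va_tensor (fixed_in A s1) (fixed_in B s2) = tensor_part false.
Proof.
rewrite /tensor_part; congr va_tensor; apply/seteqP.
  by split=> v [hA hs]; split=> //; move: hs; rewrite scale1r.
by split=> v [hB hs]; split=> //; move: hs; rewrite scale1r.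
Qed.

Lemma tensor_part_vac : tensor_part false (vac V).
Proof.
apply: sub_lin_span; exists (vac V); first exact: sgn_part_vac.
by exists (vac V); [exact: sgn_part_vac|exact: Y_vacrN1].
Qed.

(** The modes of x_{-1} y are sums of products of a mode of x, acting on the left
    factor, and a mode of y, acting on the right one. *)
Let tensor_mode x y n e t : b1 x -> b2 y -> tensor_part e t ->
  tensor_part (~~ e) (Y (Y x (-1) y) n t).
Proof.
move=> bx By; move: t.
apply: (@lin_span_min _ _ _ ((Y (Y x (-1) y) n) @^-1` tensor_part (~~ e))).
  exact: subspace_preim (tensor_part_subspace _).
move=> _ [u [Au su] [v [Bv sv] <-]] /=.
have Ax : A x by apply: sub_va_gen.
have B_y : B y by apply: sub_va_gen.
have mem p q : tensor_part (~~ e) (Y (Y x p u) (-1) (Y y q v)).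
  apply: sub_lin_span; exists (Y x p u).
    by apply: (sgn_part_mode Asub s1_aut) => //; apply: s1_sign.
  exists (Y y q v) => //.
  by apply: (sgn_part_mode Bsub s2_aut) => //; apply: s2_sign.
have yu q w : Y y q (Y u (-1) w) = Y u (-1) (Y y q w).
  exact: (commuting_modes (commuting_sym (factors_commuting Au B_y))).
have xu p w : B w -> Y x p (Y u (-1) w) = Y (Y x p u) (-1) w.
  by move=> Bw; apply: Y_tensorl; apply: factors_commuting.
apply: Y_mode_closed => [|p q|p q]; first exact: tensor_part_subspace.
  by rewrite yu xu //; apply: (subva_closed _ Bsub).
rewrite xu // -(commuting_modes (u := Y x q u)) //.
by apply: factors_commuting => //; apply: (subva_closed _ Asub).
Qed.

Lemma tensor_part_H n e t : tensor_part e t ->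
  tensor_part (~~ e) (Y (weyl_H ap am) n t).
Proof.
move=> Tt; rewrite (weyl_H_rotated weylV) Y_suml.
apply: (subspace_sum (tensor_part_subspace _)) => i il.
have jl : (l <= rev_ord i)%N by rewrite -rev_ord_lt rev_ordK.
rewrite YZl YBl; apply: (subspaceZ (tensor_part_subspace _)).
apply: (subspaceB (tensor_part_subspace _)); apply: tensor_mode => //.
- by exists i => //; left.
- by exists (rev_ord i) => //; right.
- by exists i => //; right.
- by exists (rev_ord i) => //; left.
Qed.

Let N2 := number (bp ap am) (bm ap am) (fun i : 'I_(2 * l) => l <= i)%N.
Definition parity (e : bool) : set C := [set (2 * n + e%:Z)%:~R | n in [set: int]].
Local Notation ev := (eigsum (Y N2 0)).

Let parity_shift e (c : int) a : c = 1 \/ c = -1 -> parity e a -> parity (~~ e) (a + c%:~R).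
Proof.
move=> hc [n _ <-]; rewrite -rmorphD /=.
have [k ->] : exists k, 2 * n + e%:Z + c = 2 * k + (~~ e)%:Z.
  case: hc => ->; case: e.
  - by exists (n + 1); rewrite /=; lia.
  - by exists n; rewrite /=; lia.
  - by exists n; rewrite /=; lia.
  - by exists (n - 1); rewrite /=; lia.
by exists k.
Qed.

(** A generator changes the number of particles by one. *)
Let ev_mode b e p v : b2 b -> ev (parity e) v -> ev (parity (~~ e)) (Y b p v).
Proof.
case=> i il [] ->.
- apply: (eigsum_shift (b := (-1)%:~R)) => [w|a]; last by apply: parity_shift; right.
  by rewrite /= (number_ap rpm rpp) il add0r scale1r scaleN1r.
- apply: (eigsum_shift (b := 1%:~R)) => [w|a]; last by apply: parity_shift; left.
  by rewrite /= (number_am rpm rmm) il add0r !scale1r.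
Qed.

(** On monomials in modes of the generators, the sign automorphism and the parity
    of the number operator are both given by the parity of the length. *)
Let B_split v : B v -> exists v0 v1, [/\ v = v0 + v1,
  sgn_part B s2 false v0, ev (parity false) v0,
  sgn_part B s2 true v1 & ev (parity true) v1].
Proof.
have ss e := sgn_part_subspace Bsub s2_aut e.
have es e : is_subspace (ev (parity e)) := eigsum_subspace _ _.
move: v; apply: va_gen_ind.
- split=> [|c u w [u0 [u1 [-> a1 a2 a3 a4]]] [w0 [w1 [-> d1 d2 d3 d4]]]].
    by exists 0, 0; split; rewrite ?addr0 //; (apply: (subspace0 (ss _)) || apply: (subspace0 (es _))).
  exists (c *: u0 + w0), (c *: u1 + w1); split.
  + by rewrite scalerDr addrACA.
  + by case: (ss false) => _; apply.
  + by case: (es false) => _; apply.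
  + by case: (ss true) => _; apply.
  + by case: (es true) => _; apply.
- exists (vac V), 0; split; rewrite ?addr0 //.
  + exact: sgn_part_vac.
  + apply: (@eigsum_eigen _ _ _ _ 0); first by exists 0.
    by rewrite scale0r; exact: (Y_vac_ge0 _ 0).
  + exact: (subspace0 (ss _)).
  + exact: (subspace0 (es _)).
- move=> b p v b2b [v0 [v1 [-> a1 a2 a3 a4]]].
  have Bb : B b by apply: sub_va_gen.
  exists (Y b p v1), (Y b p v0); split.
  + by rewrite YDr addrC.
  + exact: (sgn_part_mode Bsub s2_aut p Bb (s2_sign b2b) a3).
  + exact: (ev_mode p b2b a4).
  + exact: (sgn_part_mode Bsub s2_aut p Bb (s2_sign b2b) a1).
  + exact: (ev_mode p b2b a2).
Qed.

Let sgn_part_parity e v : sgn_part B s2 e v -> ev (parity e) v.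
Proof.
move=> hv; have [v0 [v1 [vE a1 a2 a3 a4]]] := B_split hv.1.
rewrite vE in hv *; case: e hv => hv.
  rewrite addrC in hv *.
  by rewrite (sgn_part_eq Bsub s2_aut a3 a1 hv) addr0.
by rewrite (sgn_part_eq Bsub s2_aut a1 a3 hv) addr0.
Qed.

Let B_N2 : B N2.
Proof.
have [sB _ cB] := Bsub.
apply: (subspace_sum sB) => i il; apply: cB; apply: sub_va_gen; exists i => //.
  by left.
by right.
Qed.

(** The zero mode of N2 commutes with the first factor, so only the parity in the
    second factor is seen; it already separates the two parts. *)
Lemma tensor_part_disjoint v : tensor_part false v -> tensor_part true v -> v = 0.
Proof.
have T_ev e : tensor_part e `<=` ev (parity e).
  apply: lin_span_min; first exact: eigsum_subspace.
  move=> _ [u [Au _] [w hw <-]].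
  apply: (eigsum_shift (b := 0)) (sgn_part_parity hw) => [t|a]; last by rewrite addr0.
  rewrite scale0r addr0 /=.
  exact: (commuting_modes (commuting_sym (factors_commuting Au B_N2))).
move=> /T_ev h0 /T_ev h1; apply: (eigsum_disjoint _ h0 h1).
move=> a [n _ <-] [k _ /intr_inj]; rewrite /=; lia.
Qed.
End Tensor.

(** * The product of two vertex algebras *)

Section Product.
Variables (C : numFieldType) (V W : vertexAlgType C).
Local Notation VW := (V * W)%type.

Definition pair_vac : VW := (vac V, vac W).
Definition pair_Y (u : VW) (n : int) (v : VW) : VW := (Y u.1 n v.1, Y u.2 n v.2).

Let pair_linearl n v : linear (fun u => pair_Y u n v).
Proof. by move=> c u w; rewrite /pair_Y /= !Y_linearl. Qed.

Let pair_linearr u n : linear (pair_Y u n).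
Proof. by move=> c v w; rewrite /pair_Y /= !Y_linearr. Qed.

Let pair_trunc u v : exists N : int, forall n : int, N <= n -> pair_Y u n v = 0.
Proof.
have [N hN] := Y_trunc u.1 v.1; have [M hM] := Y_trunc u.2 v.2.
exists (Num.max N M) => n; rewrite ge_max => /andP[Nn Mn].
by rewrite /pair_Y hN // hM.
Qed.

Let pair_vacl n v : pair_Y pair_vac n v = if n == -1 then v else 0.
Proof. by rewrite /pair_Y /= !Y_vac; case: ifP; case: v. Qed.

Let pair_vacr_ge0 v (n : nat) : pair_Y v n pair_vac = 0.
Proof. by rewrite /pair_Y !Y_vac_ge0. Qed.

Let pair_vacrN1 v : pair_Y v (-1) pair_vac = v.
Proof. by rewrite /pair_Y !Y_vacrN1; case: v. Qed.

Let pair_eta (u : VW) : u = (u.1, u.2). Proof. by case: u. Qed.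

Let pair_borcherds u v w (p q r : int) :
  exists N : nat, forall n : nat, (N <= n)%N ->
      \sum_(i < n) zbin C p i *: pair_Y (pair_Y u (r + i%:Z) v) (p + q - i%:Z) w =
      \sum_(i < n) ((-1) ^+ i * zbin C r i) *:
         (pair_Y u (p + r - i%:Z) (pair_Y v (q + i%:Z) w)
          - ((-1 : C) ^ r) *: pair_Y v (q + r - i%:Z) (pair_Y u (p + i%:Z) w)).
Proof.
have [N hN] := Y_borcherds u.1 v.1 w.1 p q r.
have [M hM] := Y_borcherds u.2 v.2 w.2 p q r.
exists (maxn N M) => n; rewrite geq_max => /andP[Nn Mn].
rewrite [LHS]pair_eta [RHS]pair_eta; congr (_, _).
  by rewrite !(raddf_sum fst) /= hN.
by rewrite !(raddf_sum snd) /= hM.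
Qed.

HB.instance Definition _ := isVertexAlgebra.Build C VW pair_linearl pair_linearr
  pair_trunc pair_vacl pair_vacr_ge0 pair_vacrN1 pair_borcherds.
End Product.

(** * Comparing two Heisenberg vertex algebras of the same level *)

Section Comparison.
Variables (C : numFieldType) (V W : vertexAlgType C) (x : V) (y : W) (k : C).
Hypothesis k_neq0 : k != 0.
Hypothesis heis_x : forall (m n : int) (w : V),
  Y x m (Y x n w) - Y x n (Y x m w) = if m + n == 0 then (m%:~R * k) *: w else 0.
Hypothesis heis_y : forall (m n : int) (w : W),
  Y y m (Y y n w) - Y y n (Y y m w) = if m + n == 0 then (m%:~R * k) *: w else 0.
Hypothesis vacV : vac V <> 0.
Hypothesis vacW : vac W <> 0.

(** The isomorphism matching x with y is obtained as its graph. *)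
Definition heis_graph : set (V * W)%type := va_gen [set (x, y)].
Local Notation G := heis_graph.

Let heis_xy (m n : int) (w : (V * W)%type) :
  Y ((x, y) : (V * W)%type) m (Y ((x, y) : (V * W)%type) n w)
  - Y ((x, y) : (V * W)%type) n (Y ((x, y) : (V * W)%type) m w)
  = if m + n == 0 then (m%:~R * k) *: w else 0.
Proof.
have : (Y x m (Y x n w.1) - Y x n (Y x m w.1), Y y m (Y y n w.2) - Y y n (Y y m w.2))
  = if m + n == 0 then (m%:~R * k) *: w else 0.
  by rewrite heis_x heis_y; case: ifP.
by [].
Qed.

Lemma heis_graph_subva : is_subva G. Proof. exact: va_gen_subva. Qed.
Let Gs : is_subspace G. Proof. by case: heis_graph_subva. Qed.

Lemma heis_graph_mode v w n : G (v, w) -> G (Y x n v, Y y n w).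
Proof.
move=> Gvw; have [_ _ cG] := heis_graph_subva.
by apply: (cG (x, y) (v, w) n _ Gvw); apply: sub_va_gen.
Qed.

Lemma heis_graph_fst v w : G (v, w) -> va_gen [set x] v.
Proof.
have [sX X1 cX] := va_gen_subva [set x].
apply: (@va_gen_ind _ _ _ [set p : (V * W)%type | va_gen [set x] p.1] _ _ _ (v, w)) => //=.
- split=> [|c u u' hu hu'] /=; first exact: (subspace0 sX).
  by case: sX => _; apply.
- move=> _ p u -> hu; apply: cX => //; exact: sub_va_gen.
Qed.

Lemma heis_graph_total v : va_gen [set x] v -> exists w, G (v, w).
Proof.
apply: (@va_gen_ind _ _ _ [set v | exists w, G (v, w)]) => /=.
- split=> [|c u u' [w hw] [w' hw']]; first by exists 0; apply: (subspace0 Gs).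
  by exists (c *: w + w'); apply: (Gs.2 c (u, w) (u', w')).
- by exists (vac W); case: heis_graph_subva.
- by move=> _ n u -> [w hw]; exists (Y y n w); apply: heis_graph_mode.
Qed.

Lemma heis_graph_surj w : va_gen [set y] w -> exists v, G (v, w).
Proof.
apply: (@va_gen_ind _ _ _ [set w | exists v, G (v, w)]) => /=.
- split=> [|c u u' [v hv] [v' hv']]; first by exists 0; apply: (subspace0 Gs).
  by exists (c *: v + v'); apply: (Gs.2 c (v, u) (v', u')).
- by exists (vac V); case: heis_graph_subva.
- by move=> _ n u -> [v hv]; exists (Y x n v); apply: heis_graph_mode.
Qed.

(** The vectors (v, 0) of the graph form an ideal that does not contain the
    vacuum; simplicity is applied in the product vertex algebra, where (x, y)
    satisfies the same relations. *)
Lemma heis_graph_inj v : G (v, 0) -> v = 0.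
Proof.
move=> Gv; suff : (v, 0) = 0 :> (V * W)%type by case.
pose J : set (V * W)%type := [set p | G p /\ p.2 = 0].
apply: (@heis_simple _ _ _ _ heis_xy k_neq0 J) => //.
- split=> [|c [a b] [a' b'] [h /= b0] [h' /= b0']]; first by split=> //; apply: (subspace0 Gs).
  by split=> /=; [apply: Gs.2|rewrite b0 b0' scaler0 addr0].
- by move=> p [].
- move=> n [a b] [h /= b0]; split=> /=; last by rewrite b0 Y0r.
  exact: heis_graph_mode.
- by move=> [_ /=].
Qed.

Lemma heis_graph_fun w : G (0, w) -> w = 0.
Proof.
move=> Gw; suff : (0, w) = 0 :> (V * W)%type by case.
pose J : set (V * W)%type := [set p | G p /\ p.1 = 0].
apply: (@heis_simple _ _ _ _ heis_xy k_neq0 J) => //.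
- split=> [|c [a b] [a' b'] [h /= b0] [h' /= b0']]; first by split=> //; apply: (subspace0 Gs).
  by split=> /=; [apply: Gs.2|rewrite b0 b0' scaler0 addr0].
- by move=> p [].
- move=> n [a b] [h /= b0]; split=> /=; last by rewrite b0 Y0r.
  exact: heis_graph_mode.
- by move=> [_ /=].
Qed.

Lemma heis_graph_sub v w v' w' : G (v, w) -> G (v', w') -> G (v - v', w - w').
Proof. by move=> h h'; apply: (subspaceB Gs h h'). Qed.

End Comparison.

(** * The Fock space is generated by its vectors of degree one *)

Section FockGenerated.
Variables (C : numFieldType) (h : vectType C) (form : h -> h -> C).
Variables (F : vertexAlgType C) (iota : {linear h -> F}).
Hypothesis heisF : is_heisenberg form iota.

Lemma heis_vac_neq0 : vac F <> 0.
Proof.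
have [phi [bphi phi1 _]] := heis_fock heisF.
rewrite -phi1 => e; have /eqP := bij_inj bphi (etrans e (esym (linear0 phi))).
by rewrite oner_eq0.
Qed.

Lemma heis_generated f : va_gen [set iota x | x in [set: h]] f.
Proof.
set G := va_gen _.
have [phi [bphi phi1 phiM]] := heis_fock heisF.
have [sG G1 cG] : is_subva G := va_gen_subva _.
suff hm (m : {cmonom ('I_(\dim (fullv : {vspace h})) * nat)%type}) c : G (phi << c *g m >>).
  case: bphi => g _ gK; rewrite -[f]gK (monalgE (g f)) linear_sum.
  by apply: (subspace_sum sG).
move en : (mdeg m) => n; elim: n m en => [|n IH] m mn.
  rewrite (mdeg_eq0I mn) -[<< _ *g _ >>]mulr1 mul_malgC linearZ /= phi1.
  exact: (subspaceZ sG).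
(* Split off one variable occurring in the monomial. *)
have [[i j] mij] : exists k, m k != 0%N.
  apply: contrapT => h0; move: mn; rewrite mdegE big1 // => k _.
  by apply/eqP; apply: contraT => mk; case: h0; exists k.
pose m' := divcm m (ucm (i, j)).
have mE : m = mmul (ucm (i, j)) m'.
  apply/eqP/cmP => k; rewrite cmM divcmE ucmE subnKC //.
  by case: eqP => // <-; rewrite lt0n.
have m'n : mdeg m' = n by move: mn; rewrite mE mdegM mdegU add1n => -[].
have -> : << c *g m >> = << ucm (i, j) >> * << c *g m' >>.
  by rewrite malgM_def fgmulUU mul1r -mE.
rewrite phiM; apply: cG; last exact: IH.
by apply: sub_va_gen; eexists.
Qed.
End FockGenerated.

(** * The isomorphism *)

Section Main.
Variables (C : numClosedFieldType) (l : nat).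
Hypothesis l_gt0 : (0 < l)%N.
Variables (M : vertexAlgType C) (ap am : 'I_(2 * l) -> M).
Hypothesis weylM : is_weyl ap am.
Variables s1 s2 : M -> M.
Hypothesis s1_aut : va_iso (va_gen (bset1 ap am)) (va_gen (bset1 ap am)) s1.
Hypothesis s1_sign : forall b : M, bset1 ap am b -> s1 b = - b.
Hypothesis s2_aut : va_iso (va_gen (bset2 ap am)) (va_gen (bset2 ap am)) s2.
Hypothesis s2_sign : forall b : M, bset2 ap am b -> s2 b = - b.
Variables (F : vertexAlgType C) (h : F).
Hypothesis heis_h : forall (m n : int) (w : F),
  Y h m (Y h n w) - Y h n (Y h m w) =
  if m + n == 0 then (m%:~R * - (2 * l)%:R) *: w else 0.
Hypothesis h_gen : forall f, va_gen [set h] f.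
Hypothesis vacF : vac F <> 0.
Variable th : F -> F.
Hypothesis th_aut : va_iso setT setT th.
Hypothesis th_h : th h = - h.

Local Notation H := (weyl_H ap am).
Local Notation T := (tensor_part ap am s1 s2).
Local Notation G := (heis_graph H h).

Let k_neq0 : - (2 * l)%:R != 0 :> C.
Proof. by rewrite oppr_eq0 pnatr_eq0 muln_eq0 -lt0n l_gt0. Qed.

Let vacM : vac M <> 0 := weyl_neq0 weylM.
Let HH := weyl_H_heis weylM.
Let Gsub := heis_graph_subva H h.
Let Gs : is_subspace G. Proof. by case: Gsub. Qed.
Let Ts e : is_subspace (T e) := tensor_part_subspace ap am s1 s2 e.

Let setT_subva : is_subva [set: F]. Proof. by []. Qed.
Let ths e := sgn_part_subspace setT_subva th_aut e.

Let graph_eq0 v w : G (v, w) -> v = 0 <-> w = 0.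
Proof.
move=> Gvw; split=> [v0|w0].
  by rewrite v0 in Gvw; apply: (heis_graph_fun k_neq0 HH heis_h vacM Gvw).
by rewrite w0 in Gvw; apply: (heis_graph_inj k_neq0 HH heis_h vacF Gvw).
Qed.

(** Both parities are flipped by each mode of (H, h). *)
Let graph_split p : G p -> exists p0 p1, [/\ p = p0 + p1, G p0, G p1,
  T false p0.1 /\ sgn_part setT th false p0.2 &
  T true p1.1 /\ sgn_part setT th true p1.2].
Proof.
move: p; apply: va_gen_ind.
- split=> [|c u w [u0 [u1 [-> a1 a2 [a3 a4] [a5 a6]]]] [w0 [w1 [-> d1 d2 [d3 d4] [d5 d6]]]]].
    exists 0, 0; split; rewrite ?addr0 //; try exact: (subspace0 Gs).
      by split; [exact: (subspace0 (Ts _))|exact: (subspace0 (ths _))].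
    by split; [exact: (subspace0 (Ts _))|exact: (subspace0 (ths _))].
  exists (c *: u0 + w0), (c *: u1 + w1); split.
  + by rewrite scalerDr addrACA.
  + exact: Gs.2.
  + exact: Gs.2.
  + by split; [exact: (Ts _).2|exact: (ths _).2].
  + by split; [exact: (Ts _).2|exact: (ths _).2].
- exists (vac _), 0; split; rewrite ?addr0 //.
  + by case: Gsub.
  + exact: (subspace0 Gs).
  + by split; [exact: tensor_part_vac|exact: (sgn_part_vac setT_subva th_aut)].
  + by split; [exact: (subspace0 (Ts _))|exact: (subspace0 (ths _))].
- move=> _ n _ -> [p0 [p1 [-> a1 a2 [a3 a4] [a5 a6]]]].
  exists (Y ((H, h) : (M * F)%type) n p1), (Y ((H, h) : (M * F)%type) n p0); split.
  + by rewrite YDr addrC.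
  + by case: p1 a2 {a5 a6} => v w; apply: heis_graph_mode.
  + by case: p0 a1 {a3 a4} => v w; apply: heis_graph_mode.
  + split; first exact: (tensor_part_H weylM s1_aut s1_sign s2_aut s2_sign n a5).
    exact: (sgn_part_mode setT_subva th_aut n _ th_h a6).
  + split; first exact: (tensor_part_H weylM s1_aut s1_sign s2_aut s2_sign n a3).
    exact: (sgn_part_mode setT_subva th_aut n _ th_h a4).
Qed.

Let graph_parity v w : G (v, w) -> T false v <-> th w = w.
Proof.
move=> Gvw; have [[v0 w0] [[v1 w1] [[vE wE] G0 G1 [/= a1 a2] [/= a3 a4]]]] := graph_split Gvw.
split=> [Tv|thw].
  have v10 : v1 = 0.
    apply: (tensor_part_disjoint weylM s2_aut s2_sign _ a3).
    have -> : v1 = v - v0 by rewrite vE addrAC subrr add0r.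
    exact: (subspaceB (Ts _)).
  have w10 : w1 = 0 by apply/(graph_eq0 G1).
  by case: a2 => _; rewrite wE w10 addr0 scale1r.
have w10 : w1 = 0.
  apply: (sgn_part_eq setT_subva th_aut a2 a4); rewrite -wE.
  by split; rewrite ?scale1r.
by have /(graph_eq0 G1) v10 := w10; rewrite vE v10 addr0.
Qed.

Lemma com_iso_heis : exists f : M -> F,
  va_iso
    (com (LC ap am)
         (va_tensor (fixed_in (va_gen (bset1 ap am)) s1)
                    (fixed_in (va_gen (bset2 ap am)) s2)))
    (fixed_in setT th) f.
Proof.
rewrite tensor_fixed.
set X := com _ _; pose f v := xget 0 [set w | G (v, w)].
have X_S v : X v -> va_gen [set H] v.
  by move=> [_ hv]; apply: com_LC_heis.
have fG v : X v -> G (v, f v).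
  by move=> /X_S /(heis_graph_total h) [w hw]; apply: (xgetPex 0 (P := [set w | G (v, w)])); exists w.
have f_eq v w : G (v, w) -> f v = w.
  move=> hw; have hf : G (v, f v) by apply: (xgetPex 0 (P := [set w | G (v, w)])); exists w.
  apply/eqP; rewrite -subr_eq0; apply/eqP; apply/(graph_eq0 (v := v - v)); last exact: subrr.
  exact: heis_graph_sub.
have GX v w : G (v, w) -> th w = w -> X v.
  move=> hw thw; split; first exact/(graph_parity hw).
  by case: (heis_com weylM (heis_graph_fst hw)).
exists f; split.
- split.
  + by move=> v Xv; split=> //; apply/(graph_parity (fG v Xv)); case: Xv.
  + move=> u v /set_mem Xu /set_mem Xv fuv.
    apply/eqP; rewrite -subr_eq0; apply/eqP.
    apply/(graph_eq0 (w := f u - f v)); last by rewrite fuv subrr.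
    by apply: heis_graph_sub; apply: fG.
  + move=> w [_ thw]; have [v hv] := heis_graph_surj H (h_gen w).
    by exists v; [apply: (GX v w)|apply: f_eq].
- by move=> c u v Xu Xv; apply: f_eq; apply: (Gs.2 c _ _ (fG u Xu) (fG v Xv)).
- by apply: f_eq; case: Gsub.
- by move=> u v n Xu Xv; apply: f_eq; apply: (subva_closed n Gsub (fG u Xu) (fG v Xv)).
Qed.
End Main.

Theorem theorem4 (R : realType) (l : nat) (l_gt0 : (0 < l)%N)
  (* the Weyl vertex algebra M_{2l} *)
  (M : vertexAlgType R[i]) (ap am : 'I_(2 * l) -> M)
  (weylM : is_weyl ap am)
  (* the sign automorphisms of its two tensor factors M_l *)
  (s1 s2 : M -> M)
  (s1_aut : va_iso (va_gen (bset1 ap am)) (va_gen (bset1 ap am)) s1)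
  (s1_sign : forall b : M, bset1 ap am b -> s1 b = - b)
  (s2_aut : va_iso (va_gen (bset2 ap am)) (va_gen (bset2 ap am)) s2)
  (s2_sign : forall b : M, bset2 ap am b -> s2 b = - b)
  (* the line h1 = C H, with <H, H> = - 2l *)
  (h1 : vectType R[i]) (inc : {linear h1 -> M}) (inc_inj : injective inc)
  (inc_im : range inc = [set c *: weyl_H ap am | c in setT])
  (form : h1 -> h1 -> R[i])
  (form_H : forall x : h1, inc x = weyl_H ap am -> form x x = - (2 * l)%:R)
  (* the Heisenberg vertex algebra M_{h1}(1) and the lift of h |-> - h *)
  (F : vertexAlgType R[i]) (iota : {linear h1 -> F})
  (heisF : is_heisenberg form iota)
  (th : F -> F) (th_aut : va_iso setT setT th)
  (th_lift : forall x : h1, th (iota x) = - iota x) :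
  exists f : M -> F,
    va_iso
      (com (LC ap am)
           (va_tensor (fixed_in (va_gen (bset1 ap am)) s1)
                      (fixed_in (va_gen (bset2 ap am)) s2)))
      (fixed_in setT th) f.
Proof.
have [x0 _ x0H] : range inc (weyl_H ap am).
  by rewrite inc_im; exists 1; rewrite ?scale1r.
apply: (com_iso_heis l_gt0 weylM s1_aut s1_sign s2_aut s2_sign (h := iota x0) _ _ _ th_aut) => //.
- by move=> m n w; rewrite (heis_comm heisF) form_H.
- move=> f; have := heis_generated heisF f.
  apply: va_gen_min; first exact: va_gen_subva.
  move=> _ [x _ <-]; have [c _ cE] : [set c *: weyl_H ap am | c in setT] (inc x).
    by rewrite -inc_im; exists x.
  have -> : x = c *: x0 by apply: inc_inj; rewrite linearZ /= x0H.
  rewrite linearZ /=; case: (va_gen_subva [set iota x0]) => sG _ _.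
  by apply: (subspaceZ sG); apply: sub_va_gen.
- exact: heis_vac_neq0 heisF.
Qed.
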